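(* Suppose that a Banach space $Z$ admits a coarse embedding or a uniform embedding into a Hilbert space. Then a subset $X\subseteq Z$ (with the induced metric) has Markov type 2 if and only if $X$ threshold-embeds into a Hilbert space.
   Context: A uniform embedding is an invertible map $f$ such that $f$ and $f^{-1}$ are uniformly continuous. A map $f:X\to L_2$ is a coarse embedding if there are non-decreasing $\alpha,\beta:[0,\infty)\to[0,\infty)$ with $\beta(t)\to\infty$ as $t\to\infty$ and $\beta(d(x,y))\le\|f(x)-f(y)\|_2\le\alpha(d(x,y))$ for all $x,y$. Markov type: $(X,d)$ has Markov type $p$ if there is $M>0$ such that for every $n$, every stationary reversible Markov chain $\{Z_t\}$ on $\{1,\dots,n\}$ (with $Z_0$ stationary), every $f:\{1,\dots,n\}\to X$ and every $t\in\mathbb N$, $\mathbb E\, d(f(Z_t),f(Z_0))^p\le M^p t\,\mathbb E\, d(f(Z_0),f(Z_1))^p$. Threshold embedding: $(X,d_X)$ $K$-threshold-embeds into $(Y,d_Y)$ if there is a family of Lipschitz maps $\{\varphi_\tau\}_{\tau>0}$ with $d_X(x,y)\ge\tau\Rightarrow d_Y(\varphi_\tau(x),\varphi_\tau(y))\ge\|\varphi_\tau\|_{\mathrm{Lip}}\tau/K$; $X$ threshold-embeds if this holds for some $K$.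
   Formalization: In the definition of threshold embedding, the Lipschitz norm of each map is replaced by some positive Lipschitz constant L, since otherwise constant maps (Lipschitz norm 0) would make every space threshold-embed and the claim would fail, e.g. for L_1. *)

(* Defs.v *)
From Stdlib Require Import Reals Lra.
Open Scope R_scope.

Record VectorSpace := {
  vs_car :> Type;
  vs_zero : vs_car;
  vs_add : vs_car -> vs_car -> vs_car;
  vs_opp : vs_car -> vs_car;
  vs_scal : R -> vs_car -> vs_car;
  vs_add_assoc : forall x y z, vs_add x (vs_add y z) = vs_add (vs_add x y) z;
  vs_add_comm : forall x y, vs_add x y = vs_add y x;
  vs_add_zero : forall x, vs_add vs_zero x = x;
  vs_add_opp : forall x, vs_add x (vs_opp x) = vs_zero;
  vs_scal_assoc : forall a b x, vs_scal a (vs_scal b x) = vs_scal (a * b) x;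
  vs_scal_one : forall x, vs_scal 1 x = x;
  vs_scal_distr_l : forall a x y, vs_scal a (vs_add x y) = vs_add (vs_scal a x) (vs_scal a y);
  vs_scal_distr_r : forall a b x, vs_scal (a + b) x = vs_add (vs_scal a x) (vs_scal b x)
}.

Definition vs_sub (V : VectorSpace) (x y : V) : V := vs_add V x (vs_opp V y).

Definition complete_wrt (V : VectorSpace) (nrm : V -> R) : Prop :=
  forall u : nat -> V,
    (forall eps, 0 < eps -> exists N, forall m n, (N <= m)%nat -> (N <= n)%nat ->
        nrm (vs_sub V (u m) (u n)) < eps) ->
    exists l : V, forall eps, 0 < eps -> exists N, forall n, (N <= n)%nat ->
        nrm (vs_sub V (u n) l) < eps.

Record BanachSpace := {
  bs_vs :> VectorSpace;
  bs_norm : bs_vs -> R;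
  bs_norm_nonneg : forall x, 0 <= bs_norm x;
  bs_norm_zero : forall x, bs_norm x = 0 -> x = vs_zero bs_vs;
  bs_norm_scal : forall a x, bs_norm (vs_scal bs_vs a x) = Rabs a * bs_norm x;
  bs_norm_triangle : forall x y,
      bs_norm (vs_add bs_vs x y) <= bs_norm x + bs_norm y;
  bs_complete : complete_wrt bs_vs bs_norm
}.

Definition bdist (Z : BanachSpace) (x y : Z) : R := bs_norm Z (vs_sub Z x y).

Record HilbertSpace := {
  hs_vs :> VectorSpace;
  hs_inner : hs_vs -> hs_vs -> R;
  hs_inner_sym : forall x y, hs_inner x y = hs_inner y x;
  hs_inner_add : forall x y z,
      hs_inner (vs_add hs_vs x y) z = hs_inner x z + hs_inner y z;
  hs_inner_scal : forall a x y, hs_inner (vs_scal hs_vs a x) y = a * hs_inner x y;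
  hs_inner_pos : forall x, 0 <= hs_inner x x;
  hs_inner_def : forall x, hs_inner x x = 0 -> x = vs_zero hs_vs;
  hs_complete : complete_wrt hs_vs (fun x => sqrt (hs_inner x x))
}.

Definition hnorm (H : HilbertSpace) (x : H) : R := sqrt (hs_inner H x x).
Definition hdist (H : HilbertSpace) (x y : H) : R := hnorm H (vs_sub H x y).

Definition nondecr_nonneg (a : R -> R) : Prop :=
  (forall t, 0 <= t -> 0 <= a t) /\
  (forall s t, 0 <= s -> s <= t -> a s <= a t).

Definition coarse_embedding (Z : BanachSpace) (H : HilbertSpace) (f : Z -> H) : Prop :=
  exists alpha beta : R -> R,
    nondecr_nonneg alpha /\ nondecr_nonneg beta /\
    (forall M, exists T, forall t, T <= t -> M <= beta t) /\
    (forall x y, beta (bdist Z x y) <= hdist H (f x) (f y) /\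
                 hdist H (f x) (f y) <= alpha (bdist Z x y)).

Definition uniform_embedding (Z : BanachSpace) (H : HilbertSpace) (f : Z -> H) : Prop :=
  (forall x y, f x = f y -> x = y) /\
  (forall eps, 0 < eps -> exists delta, 0 < delta /\
      forall x y, bdist Z x y < delta -> hdist H (f x) (f y) < eps) /\
  (forall eps, 0 < eps -> exists delta, 0 < delta /\
      forall x y, hdist H (f x) (f y) < delta -> bdist Z x y < eps).

Fixpoint fsum (n : nat) (g : nat -> R) : R :=
  match n with
  | O => 0
  | S m => fsum m g + g m
  end.

Fixpoint mpow (n : nat) (P : nat -> nat -> R) (t : nat) : nat -> nat -> R :=
  match t with
  | O => fun i j => if Nat.eqb i j then 1 else 0
  | S t' => fun i j => fsum n (fun k => mpow n P t' i k * P k j)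
  end.

Definition stationary_reversible (n : nat) (P : nat -> nat -> R) (pi : nat -> R) : Prop :=
  (forall i j, (i < n)%nat -> (j < n)%nat -> 0 <= P i j) /\
  (forall i, (i < n)%nat -> fsum n (fun j => P i j) = 1) /\
  (forall i, (i < n)%nat -> 0 <= pi i) /\
  fsum n pi = 1 /\
  (forall j, (j < n)%nat -> fsum n (fun i => pi i * P i j) = pi j) /\
  (forall i j, (i < n)%nat -> (j < n)%nat -> pi i * P i j = pi j * P j i).

(** Markov type 2: E d(f(Z_t),f(Z_0))^2 <= M^2 t E d(f(Z_0),f(Z_1))^2,
    where E g(Z_0,Z_t) = sum_{i,j} pi_i (P^t)_{ij} g(i,j). *)
Definition markov_type2 {T : Type} (d : T -> T -> R) : Prop :=
  exists M, 0 < M /\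
    forall (n : nat) (P : nat -> nat -> R) (pi : nat -> R),
      stationary_reversible n P pi ->
      forall (f : nat -> T) (t : nat),
        fsum n (fun i => fsum n (fun j => pi i * mpow n P t i j * (d (f i) (f j)) ^ 2))
        <= M ^ 2 * INR t *
           fsum n (fun i => fsum n (fun j => pi i * P i j * (d (f i) (f j)) ^ 2)).

Definition threshold_embeds_K {T : Type} (d : T -> T -> R) (H : HilbertSpace) (K : R) : Prop :=
  forall tau, 0 < tau ->
    exists (phi : T -> H) (L : R), 0 < L /\
      (forall x y, hdist H (phi x) (phi y) <= L * d x y) /\
      (forall x y, tau <= d x y -> L * tau / K <= hdist H (phi x) (phi y)).

Definition threshold_embeds {T : Type} (d : T -> T -> R) (H : HilbertSpace) : Prop :=
  exists K, 0 < K /\ threshold_embeds_K d H K.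

Definition subset_dist (Z : BanachSpace) (X : Z -> Prop) (a b : {z : Z | X z}) : R :=
  bdist Z (proj1_sig a) (proj1_sig b).

(* Main.v *)
Require Import Defs.
From Stdlib Require Import Reals Lra Lia Psatz List Classical ClassicalEpsilon.
From mathcomp Require filter.
Open Scope R_scope.

(** Threshold embeddings give Markov type 2 (Ding, Lee and Peres): a function of a
    stationary reversible chain splits into a forward and a backward martingale.  At scale
    [tau] one discards jumps longer than [tau] and stops when the conditional variance
    exceeds [tau ^ 2]; the fourth moment of the stopped martingale decays fast enough for
    the tail bounds to be summable over dyadic scales.

    Conversely, a rescaled embedding [f] of [Z] is Lipschitz at large distances, and it is
    enough to find a genuinely Lipschitz map on [X] uniformly close to [f].  As in Ball's
    extension theorem, convex duality reduces this to minimising a single weighted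
    Dirichlet energy; the minimiser averages [f] along a reversible chain run for a
    geometric time, and Markov type 2 bounds its energy.  Finite subsets are glued by weak
    limits along an ultrafilter. *)

(** * Finite sums *)

(** The bounds wanted from a Lipschitz approximation, [|F x - f x|^2 <= a] and
    [|F x - F y|^2 <= 2 b M^2 d^2], are convex in [F], so it is enough to satisfy every
    nonnegatively weighted sum of them. The energy of the optimal [F] is half the mean of
    [|f i - f j|^2] over the ends of a reversible walk run for a geometric time of mean [1/kappa].
    Markov type costs that factor, while the walk moves at a rate proportional to [kappa], so
    [kappa] cancels and the bound is uniform in the weights. The error [a] is affordable because an
    embedding of [Z] separates far points by several times its oscillation at a small scale.

    In the other direction the map changes with [tau], so second moments do not suffice: Chebyshev
    bounds [tau^2 Prob (d >= tau)] by the same quantity at every scale, and the sum over scales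
    diverges. After truncation each jump and each path variance enters as a series that grows
    geometrically up to its own scale and decays or vanishes beyond it. *)

Lemma fsum_ext n g h : (forall i, (i < n)%nat -> g i = h i) -> fsum n g = fsum n h.
Proof.
  induction n as [|n IH]; intros E; simpl; [reflexivity|].
  rewrite IH, E; auto with arith.
Qed.

Lemma fsum_le n g h : (forall i, (i < n)%nat -> g i <= h i) -> fsum n g <= fsum n h.
Proof.
  induction n as [|n IH]; intros E; simpl; [lra|].
  apply Rplus_le_compat; auto with arith.
Qed.

Lemma fsum_plus n g h : fsum n (fun i => g i + h i) = fsum n g + fsum n h.
Proof. induction n; simpl; lra. Qed.

Lemma fsum_minus n g h : fsum n (fun i => g i - h i) = fsum n g - fsum n h.
Proof. induction n; simpl; lra. Qed.

Lemma fsum_scal n c g : fsum n (fun i => c * g i) = c * fsum n g.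
Proof. induction n as [|n IH]; simpl; [|rewrite IH]; lra. Qed.

Lemma fsum_scal_r n c g : fsum n (fun i => g i * c) = fsum n g * c.
Proof. induction n as [|n IH]; simpl; [|rewrite IH]; lra. Qed.

Lemma fsum_zero n : fsum n (fun _ => 0) = 0.
Proof. induction n as [|n IH]; simpl; lra. Qed.

Lemma fsum_const n c : fsum n (fun _ => c) = INR n * c.
Proof. induction n as [|n IH]; [simpl; lra|]. rewrite S_INR; simpl; lra. Qed.

Lemma fsum_nonneg n g : (forall i, (i < n)%nat -> 0 <= g i) -> 0 <= fsum n g.
Proof. intros E. rewrite <- (fsum_zero n). now apply fsum_le. Qed.

Lemma fsum_swap n m g :
  fsum n (fun i => fsum m (fun j => g i j)) = fsum m (fun j => fsum n (fun i => g i j)).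
Proof.
  induction n as [|n IH]; simpl; [now rewrite fsum_zero|].
  now rewrite IH, fsum_plus.
Qed.

Lemma fsum_term_le n g k :
  (forall i, (i < n)%nat -> 0 <= g i) -> (k < n)%nat -> g k <= fsum n g.
Proof.
  induction n as [|n IH]; intros E Hk; [lia|]; simpl.
  assert (0 <= fsum n g) by (apply fsum_nonneg; auto with arith).
  destruct (Nat.eq_dec k n) as [->|Hn]; [lra|].
  assert (0 <= g n) by auto with arith.
  assert (g k <= fsum n g) by (apply IH; auto with arith; lia). lra.
Qed.

Lemma fsum_delta n k g :
  (k < n)%nat -> fsum n (fun i => (if Nat.eqb k i then 1 else 0) * g i) = g k.
Proof.
  intros Hk.
  assert (Z : forall m, (m <= k)%nat ->
            fsum m (fun i => (if Nat.eqb k i then 1 else 0) * g i) = 0).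
  { intros m Hm. transitivity (fsum m (fun _ => 0)); [|apply fsum_zero].
    apply fsum_ext. intros i Hi.
    destruct (Nat.eqb_spec k i); [lia|simpl; ring]. }
  induction n as [|n IH]; [lia|]; simpl.
  destruct (Nat.eqb_spec k n) as [->|Hn].
  - rewrite Z by lia. ring.
  - rewrite IH by lia. ring.
Qed.

(** The variance of [y] under [p] is nonnegative. *)
Lemma fsum_jensen_sqr n p y :
  (forall i, (i < n)%nat -> 0 <= p i) -> fsum n p = 1 ->
  (fsum n (fun i => p i * y i)) ^ 2 <= fsum n (fun i => p i * y i ^ 2).
Proof.
  intros Hp H1. set (m := fsum n (fun i => p i * y i)).
  assert (H : 0 <= fsum n (fun i => p i * (y i - m) ^ 2)).
  { apply fsum_nonneg. intros i Hi. apply Rmult_le_pos; [auto|apply pow2_ge_0]. }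
  rewrite (fsum_ext _ _ (fun i => p i * y i ^ 2 - 2 * m * (p i * y i) + m ^ 2 * p i)) in H
    by (intros; ring).
  rewrite fsum_plus, fsum_minus, !fsum_scal, H1 in H. fold m in H. nra.
Qed.

(** The square inequality is used twice, for [y] and for [y ^ 2]. *)
Lemma fsum_jensen_pow4 n p y :
  (forall i, (i < n)%nat -> 0 <= p i) -> fsum n p = 1 ->
  (fsum n (fun i => p i * y i)) ^ 4 <= fsum n (fun i => p i * y i ^ 4).
Proof.
  intros Hp H1.
  assert (A := fsum_jensen_sqr n p y Hp H1).
  assert (B := fsum_jensen_sqr n p (fun i => y i ^ 2) Hp H1).
  rewrite (fsum_ext _ (fun i => p i * y i ^ 4) (fun i => p i * (y i ^ 2) ^ 2))
    by (intros; ring).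
  eapply Rle_trans; [|exact B].
  replace (fsum n (fun i => p i * y i) ^ 4)
    with ((fsum n (fun i => p i * y i) ^ 2) ^ 2) by ring.
  apply pow_incr. split; [apply pow2_ge_0|exact A].
Qed.

(** * Powers of a Markov kernel *)

(** [mpow] splits off the last step; reversibility and the resolvent equation condition on the first
    one. *)
Lemma mpow_succ_left n P t i j : (i < n)%nat -> (j < n)%nat ->
  mpow n P (S t) i j = fsum n (fun k => P i k * mpow n P t k j).
Proof.
  revert j. induction t as [|t IH]; intros j Hi Hj.
  - simpl. rewrite fsum_delta by easy.
    rewrite (fsum_ext _ _ (fun k => (if Nat.eqb j k then 1 else 0) * P i k)).
    + now rewrite fsum_delta.
    + intros k Hk. rewrite (Nat.eqb_sym j k). ring.
  - change (fsum n (fun k => mpow n P (S t) i k * P k j) =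
            fsum n (fun k => P i k * fsum n (fun l => mpow n P t k l * P l j))).
    rewrite (fsum_ext _ _ (fun k => fsum n (fun l => P i l * mpow n P t l k * P k j))).
    + rewrite fsum_swap. apply fsum_ext. intros k Hk. rewrite <- fsum_scal.
      apply fsum_ext. intros; ring.
    + intros k Hk. rewrite IH by easy. rewrite fsum_scal_r. reflexivity.
Qed.

Section ReversibleChain.

Variables (n : nat) (P : nat -> nat -> R) (pi : nat -> R).
Hypothesis HP : stationary_reversible n P pi.

Lemma kernel_nonneg i j : (i < n)%nat -> (j < n)%nat -> 0 <= P i j.
Proof. destruct HP; auto. Qed.

Lemma kernel_sum i : (i < n)%nat -> fsum n (P i) = 1.
Proof. destruct HP as (_ & H & _); apply H. Qed.

Lemma pi_nonneg i : (i < n)%nat -> 0 <= pi i.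
Proof. destruct HP as (_ & _ & H & _); apply H. Qed.

Lemma pi_sum : fsum n pi = 1.
Proof. destruct HP as (_ & _ & _ & H & _); apply H. Qed.

Lemma pi_stationary j : (j < n)%nat -> fsum n (fun i => pi i * P i j) = pi j.
Proof. destruct HP as (_ & _ & _ & _ & H & _); apply H. Qed.

Lemma pi_reversible i j : (i < n)%nat -> (j < n)%nat -> pi i * P i j = pi j * P j i.
Proof. destruct HP as (_ & _ & _ & _ & _ & H); apply H. Qed.

Lemma pi_kernel_sum (g : nat -> R) :
  fsum n (fun i => pi i * fsum n (fun j => P i j * g j)) = fsum n (fun i => pi i * g i).
Proof.
  rewrite (fsum_ext _ _ (fun i => fsum n (fun j => pi i * P i j * g j)))
    by (intros; rewrite <- fsum_scal; apply fsum_ext; intros; ring).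
  rewrite fsum_swap. apply fsum_ext. intros j Hj.
  now rewrite fsum_scal_r, pi_stationary.
Qed.

Lemma mpow_nonneg t i j : (i < n)%nat -> (j < n)%nat -> 0 <= mpow n P t i j.
Proof.
  revert j. induction t as [|t IH]; intros j Hi Hj; simpl.
  - destruct Nat.eqb; lra.
  - apply fsum_nonneg. intros k Hk. apply Rmult_le_pos; [auto|now apply kernel_nonneg].
Qed.

Lemma mpow_sum t i : (i < n)%nat -> fsum n (mpow n P t i) = 1.
Proof.
  intros Hi. induction t as [|t IH]; simpl.
  - rewrite (fsum_ext _ _ (fun j => (if Nat.eqb i j then 1 else 0) * 1)) by (intros; ring).
    now rewrite fsum_delta.
  - rewrite fsum_swap, <- IH. apply fsum_ext. intros k Hk.
    now rewrite fsum_scal, kernel_sum, Rmult_1_r.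
Qed.

Lemma mpow_reversible t i j : (i < n)%nat -> (j < n)%nat ->
  pi i * mpow n P t i j = pi j * mpow n P t j i.
Proof.
  revert i j. induction t as [|t IH]; intros i j Hi Hj.
  - simpl. rewrite (Nat.eqb_sym j i). destruct (Nat.eqb_spec i j); [now subst|ring].
  - rewrite (mpow_succ_left _ _ _ j i) by easy. simpl.
    rewrite <- !fsum_scal. apply fsum_ext. intros k Hk.
    rewrite <- (Rmult_assoc (pi i)), IH by easy.
    rewrite <- (Rmult_assoc (pi j)), (pi_reversible j k) by easy. ring.
Qed.

End ReversibleChain.

(** * Hilbert spaces *)

Fixpoint vsum (V : VectorSpace) (n : nat) (g : nat -> V) : V :=
  match n with
  | O => vs_zero V
  | S m => vs_add V (vsum V m g) (g m)
  end.

Section Hilbert.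

Variable H : HilbertSpace.

Local Notation inner := (hs_inner H).
Local Notation add := (vs_add H).
Local Notation opp := (vs_opp H).
Local Notation sub := (vs_sub H).
Local Notation scal := (vs_scal H).
Local Notation zero := (vs_zero H).
Local Notation norm := (hnorm H).

Lemma inner_add_r x y z : inner z (add x y) = inner z x + inner z y.
Proof. now rewrite hs_inner_sym, hs_inner_add, !(hs_inner_sym _ z). Qed.

Lemma inner_scal_r a x y : inner y (scal a x) = a * inner y x.
Proof. now rewrite hs_inner_sym, hs_inner_scal, (hs_inner_sym _ y). Qed.

Lemma inner_zero_l y : inner zero y = 0.
Proof.
  assert (E := hs_inner_add H zero zero y). rewrite vs_add_zero in E. lra.
Qed.

Lemma inner_zero_r y : inner y zero = 0.
Proof. now rewrite hs_inner_sym, inner_zero_l. Qed.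

Lemma inner_opp_l x y : inner (opp x) y = - inner x y.
Proof.
  assert (E := hs_inner_add H x (opp x) y).
  rewrite vs_add_opp, inner_zero_l in E. lra.
Qed.

Lemma inner_opp_r x y : inner y (opp x) = - inner y x.
Proof. now rewrite hs_inner_sym, inner_opp_l, (hs_inner_sym _ y). Qed.

Lemma inner_sub_l x y z : inner (sub x y) z = inner x z - inner y z.
Proof. unfold vs_sub. rewrite hs_inner_add, inner_opp_l. lra. Qed.

Lemma inner_sub_r x y z : inner z (sub x y) = inner z x - inner z y.
Proof. unfold vs_sub. rewrite inner_add_r, inner_opp_r. lra. Qed.

Lemma inner_vsum_l n g z : inner (vsum H n g) z = fsum n (fun i => inner (g i) z).
Proof.
  induction n as [|n IH]; simpl; [apply inner_zero_l|].
  now rewrite hs_inner_add, IH.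
Qed.

(* Reduces linear identities between vectors to [ring] in R. *)
Lemma inner_ext x y : (forall w, inner x w = inner y w) -> x = y.
Proof.
  intros E.
  assert (D : sub x y = zero).
  { apply hs_inner_def. rewrite inner_sub_l, E. lra. }
  transitivity (add (sub x y) y).
  - unfold vs_sub.
    now rewrite <- vs_add_assoc, (vs_add_comm _ _ y), vs_add_opp, vs_add_comm, vs_add_zero.
  - now rewrite D, vs_add_zero.
Qed.

Lemma hnorm_nonneg x : 0 <= norm x.
Proof. apply sqrt_pos. Qed.

Lemma hnorm_sqr x : norm x ^ 2 = inner x x.
Proof. apply pow2_sqrt, hs_inner_pos. Qed.

Lemma hnorm_le x c : 0 <= c -> inner x x <= c ^ 2 -> norm x <= c.
Proof.
  intros Hc Hx. rewrite <- (sqrt_pow2 c Hc). now apply sqrt_le_1_alt.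
Qed.

Lemma cauchy_schwarz x y : inner x y <= norm x * norm y.
Proof.
  assert (Q : forall s, 0 <= inner x x - 2 * s * inner x y + s ^ 2 * inner y y).
  { intros s. replace (_ + _) with (inner (sub x (scal s y)) (sub x (scal s y))).
    - apply hs_inner_pos.
    - rewrite !inner_sub_l, !inner_sub_r, !hs_inner_scal, !inner_scal_r,
        (hs_inner_sym _ y x). ring. }
  assert (S : inner x y ^ 2 <= inner x x * inner y y).
  { destruct (Req_dec (inner y y) 0) as [E|E].
    - apply hs_inner_def in E. subst y. rewrite !inner_zero_r. lra.
    - assert (0 < inner y y) by (pose proof (hs_inner_pos H y); lra).
      specialize (Q (inner x y / inner y y)).
      apply (Rmult_le_compat_r (inner y y)) in Q; [|lra].
      replace ((inner x x - 2 * (inner x y / inner y y) * inner x y +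
        (inner x y / inner y y) ^ 2 * inner y y) * inner y y)
        with (inner x x * inner y y - inner x y ^ 2) in Q by (field; lra). lra. }
  rewrite <- !hnorm_sqr, <- Rpow_mult_distr in S.
  apply Rsqr_incr_0_var; [|apply Rmult_le_pos; apply hnorm_nonneg].
  rewrite !Rsqr_pow2. exact S.
Qed.

Lemma cauchy_schwarz_abs x y : Rabs (inner x y) <= norm x * norm y.
Proof.
  apply Rabs_le. split; [|apply cauchy_schwarz].
  assert (E := cauchy_schwarz (opp x) y). rewrite inner_opp_l in E.
  replace (norm (opp x)) with (norm x) in E; [lra|].
  unfold hnorm. now rewrite inner_opp_l, inner_opp_r, Ropp_involutive.
Qed.

Lemma hnorm_triangle x y : norm (add x y) <= norm x + norm y.
Proof.
  assert (Hx := hnorm_nonneg x). assert (Hy := hnorm_nonneg y).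
  apply hnorm_le; [lra|].
  rewrite hs_inner_add, !inner_add_r, (hs_inner_sym _ y x), <- !hnorm_sqr.
  assert (E := cauchy_schwarz x y). nra.
Qed.

Lemma hnorm_zero : norm zero = 0.
Proof. unfold hnorm. rewrite inner_zero_l. apply sqrt_0. Qed.

Lemma hnorm_scal a x : norm (scal a x) = Rabs a * norm x.
Proof.
  unfold hnorm. rewrite hs_inner_scal, inner_scal_r, <- Rmult_assoc.
  rewrite sqrt_mult_alt by nra. f_equal. apply sqrt_Rsqr_abs.
Qed.

Lemma hnorm_sub_sym x y : norm (sub x y) = norm (sub y x).
Proof.
  unfold hnorm. f_equal. rewrite !inner_sub_l, !inner_sub_r. ring.
Qed.

Lemma hnorm_sub_triangle x y : norm (sub x y) <= norm x + norm y.
Proof.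
  unfold vs_sub. eapply Rle_trans; [apply hnorm_triangle|].
  replace (norm (opp y)) with (norm y); [lra|].
  unfold hnorm. now rewrite inner_opp_l, inner_opp_r, Ropp_involutive.
Qed.

Lemma hdist_triangle x y z : hdist H x z <= hdist H x y + hdist H y z.
Proof.
  unfold hdist. replace (sub x z) with (add (sub x y) (sub y z)).
  - apply hnorm_triangle.
  - apply inner_ext. intros w. rewrite hs_inner_add, !inner_sub_l. ring.
Qed.

Lemma hdist_sym x y : hdist H x y = hdist H y x.
Proof. apply hnorm_sub_sym. Qed.

Lemma hdist_nonneg x y : 0 <= hdist H x y.
Proof. apply hnorm_nonneg. Qed.

Lemma hdist_sqr x y : hdist H x y ^ 2 = inner x x - 2 * inner x y + inner y y.
Proof.
  unfold hdist. rewrite hnorm_sqr, !inner_sub_l, !inner_sub_r, (hs_inner_sym _ y x). ring.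
Qed.

Lemma hnorm_vsum n g : norm (vsum H n g) <= fsum n (fun i => norm (g i)).
Proof.
  induction n as [|n IH]; simpl; [rewrite hnorm_zero; lra|].
  eapply Rle_trans; [apply hnorm_triangle|lra].
Qed.

(** * The Riesz representation theorem *)

(** The representing vector minimises [J x = |x|^2 - 2 l x]. Minimising sequences are Cauchy by the
    parallelogram law, and [inner u w = l w] says that the first variation of [J] vanishes. *)
Lemma riesz (l : H -> R) (c : R) :
  0 <= c ->
  (forall x y, l (add x y) = l x + l y) ->
  (forall a x, l (scal a x) = a * l x) ->
  (forall x, Rabs (l x) <= c * norm x) ->
  exists u, forall w, inner u w = l w.
Proof.
  intros Hc Ladd Lscal Lbd.
  set (J := fun x => inner x x - 2 * l x).
  assert (Jlow : forall x, - c ^ 2 <= J x).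
  { intros x. unfold J. rewrite <- hnorm_sqr.
    assert (B := Lbd x). assert (l x <= Rabs (l x)) by apply Rle_abs.
    assert (0 <= (norm x - c) ^ 2) by apply pow2_ge_0. nra. }
  (* [completeness] yields suprema, so the infimum of [J] appears as [- s]. *)
  destruct (completeness (fun r => exists x, r = - J x)) as [s [Ub Lub]].
  { exists (c ^ 2). intros r [x ->]. specialize (Jlow x). lra. }
  { now exists (- J zero), zero. }
  assert (Jinf : forall x, - s <= J x).
  { intros x. assert (- J x <= s) by (apply Ub; now exists x). lra. }
  assert (Jnear : forall e, 0 < e -> exists x, J x <= - s + e).
  { intros e He. apply NNPP. intros No.
    assert (s <= s - e); [|lra].
    apply Lub. intros r [x ->]. destruct (Rle_dec (J x) (- s + e)); [|lra].
    exfalso. apply No. now exists x. }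
  assert (Hn : forall n, 0 < / INR (S n))
    by (intros n; apply Rinv_0_lt_compat, lt_0_INR; lia).
  destruct (choice (fun n x => J x <= - s + / INR (S n))) as [u Hu].
  { intros n. apply Jnear, Hn. }
  assert (Parallelogram : forall x y,
    inner (sub x y) (sub x y) = 2 * J x + 2 * J y - 4 * J (scal (/ 2) (add x y))).
  { intros x y. unfold J. rewrite Lscal, Ladd.
    rewrite !inner_sub_l, !inner_sub_r, !hs_inner_scal, !inner_scal_r, !hs_inner_add,
      !inner_add_r. field. }
  destruct (hs_complete H u) as [v Hv].
  { intros e He. destruct (archimed_cor1 (e ^ 2 / 4)) as [N [HN HN0]]; [nra|].
    exists N. intros m n Hm Hn'.
    change (norm (sub (u m) (u n)) < e).
    assert (I : forall k, (N <= k)%nat -> / INR (S k) < e ^ 2 / 4).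
    { intros k Hk. eapply Rle_lt_trans; [|exact HN].
      apply Rinv_le_contravar; [apply lt_0_INR; lia|apply le_INR; lia]. }
    assert (A := I m Hm). assert (B := I n Hn').
    assert (Q := Parallelogram (u m) (u n)).
    assert (Q' := Jinf (scal (/ 2) (add (u m) (u n)))).
    assert (Q1 := Hu m). assert (Q2 := Hu n).
    rewrite <- hnorm_sqr in Q. assert (N0 := hnorm_nonneg (sub (u m) (u n))). nra. }
  exists v. intros w.
  (* The first variation is estimated at the near-minimisers [u n], where it is of order
     [sqrt (1 / (n + 1))]; passing to the limit then uses only the continuity of [inner]. *)
  assert (Var : forall n, (inner (u n) w - l w) ^ 2 <= inner w w * / INR (S n)).
  { intros n. set (b := inner (u n) w - l w). set (e := / INR (S n)).
    assert (Q : forall r, 0 <= e + 2 * r * b + r ^ 2 * inner w w).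
    { intros r. assert (A := Hu n). assert (B := Jinf (add (u n) (scal r w))).
      fold e in A. unfold J in A, B. unfold b.
      rewrite Ladd, Lscal, hs_inner_add, !inner_add_r, !hs_inner_scal, !inner_scal_r,
        (hs_inner_sym _ w (u n)) in B. nra. }
    assert (W := hs_inner_pos H w).
    destruct (Req_dec (inner w w) 0) as [E|E].
    - assert (b = 0) as ->; [|rewrite E; lra].
      destruct (Req_dec b 0) as [|Hb]; [easy|].
      (* For [w] of norm zero the expression is affine in [r], and this [r] gives it the value
         -1. *)
      specialize (Q (- (e + 1) / (2 * b))). rewrite E in Q.
      replace (e + 2 * (- (e + 1) / (2 * b)) * b + (- (e + 1) / (2 * b)) ^ 2 * 0)
        with (-1) in Q by (field; easy). lra.
    (* The minimiser of the quadratic in [r]. *)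
    - specialize (Q (- b / inner w w)).
      apply (Rmult_le_compat_r (inner w w)) in Q; [|lra].
      replace ((e + 2 * (- b / inner w w) * b + (- b / inner w w) ^ 2 * inner w w)
        * inner w w) with (inner w w * e - b ^ 2) in Q by (field; easy). lra. }
  apply Rminus_diag_uniq, cond_eq. intros e He. rewrite Rminus_0_r.
  assert (W := hnorm_nonneg w).
  set (K := norm w + 1).
  destruct (Hv (e / (2 * K))) as [N1 HN1].
  { apply Rdiv_lt_0_compat; unfold K; lra. }
  destruct (archimed_cor1 ((e / (2 * K)) ^ 2)) as [N2 [HN2 HN20]].
  { apply pow_lt, Rdiv_lt_0_compat; unfold K; lra. }
  set (n := Nat.max N1 N2).
  assert (A : norm (sub (u n) v) < e / (2 * K)) by (apply HN1; lia).
  assert (B := Var n). assert (C := cauchy_schwarz_abs (sub (u n) v) w).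
  rewrite inner_sub_l in C.
  assert (I : / INR (S n) <= / INR N2)
    by (apply Rinv_le_contravar; [apply lt_0_INR; lia|apply le_INR; lia]).
  set (d := e / (2 * K)) in *.
  assert (Hd : 0 < d) by (apply Rdiv_lt_0_compat; unfold K; lra).
  assert (Ed : 2 * K * d = e) by (unfold d; field; unfold K; lra).
  assert (B' : Rabs (inner (u n) w - l w) <= norm w * d).
  { rewrite <- hnorm_sqr in B. apply Rabs_le.
    assert (S2 : (inner (u n) w - l w) ^ 2 <= (norm w * d) ^ 2).
    { rewrite Rpow_mult_distr. eapply Rle_trans; [exact B|].
      apply Rmult_le_compat_l; [apply pow2_ge_0|lra]. }
    assert (0 <= norm w * d) by nra. split; nra. }
  replace (inner v w - l w)
    with (- (inner (u n) w - inner v w) + (inner (u n) w - l w)) by ring.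
  eapply Rle_lt_trans; [apply Rabs_triang|]. rewrite Rabs_Ropp.
  assert (C' : norm (sub (u n) v) * norm w <= d * norm w)
    by (apply Rmult_le_compat_r; lra).
  unfold K in Ed. nra.
Qed.

End Hilbert.

(** * A finite minimax principle *)

(* Blackwell's approachability scheme: the current excesses [Rmax 0 (q F i j)] serve as
   weights, and moving a step [1/(k+2)] towards a point that is good for these weights
   makes the sum of the squared excesses decay like [1/k]. *)
Lemma convex_minimax (V : Type) (S : V -> Prop) (mix : R -> V -> V -> V)
  (n m : nat) (q : V -> nat -> nat -> R) (B : R) :
  (forall s F G, 0 <= s <= 1 -> S F -> S G -> S (mix s F G) /\
     forall i j, (i < n)%nat -> (j < m)%nat ->
       q (mix s F G) i j <= (1 - s) * q F i j + s * q G i j) ->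
  (forall F i j, S F -> (i < n)%nat -> (j < m)%nat -> Rabs (q F i j) <= B) ->
  (forall h : nat -> nat -> R, (forall i j, 0 <= h i j) -> forall e, 0 < e ->
     exists F, S F /\ fsum n (fun i => fsum m (fun j => h i j * q F i j)) <= e) ->
  forall e, 0 < e ->
  exists F, S F /\ forall i j, (i < n)%nat -> (j < m)%nat -> q F i j <= e.
Proof.
  intros Hconv Hbd Hdual e He.
  set (Phi := fun F => fsum n (fun i => fsum m (fun j => Rmax 0 (q F i j) ^ 2))).
  (* The extra 1 keeps the tolerance [s * BB / 2] used below positive. *)
  set (BB := fsum n (fun _ => fsum m (fun _ => B ^ 2)) + 1).
  assert (HBB : 1 <= BB).
  { assert (0 <= fsum n (fun _ => fsum m (fun _ => B ^ 2))); [|unfold BB; lra].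
    apply fsum_nonneg; intros; apply fsum_nonneg; intros; apply pow2_ge_0. }
  assert (Hsq : forall F i j, S F -> (i < n)%nat -> (j < m)%nat -> q F i j ^ 2 <= B ^ 2).
  { intros F i j HF Hi Hj. rewrite <- pow2_abs. apply pow_incr.
    split; [apply Rabs_pos|auto]. }
  assert (Step : forall k : nat, exists F, S F /\ Phi F <= 2 * BB / (INR k + 1)).
  { induction k as [|k [F [HF HPhi]]].
    (* Zero weights merely provide a starting point in [S]. *)
    - destruct (Hdual (fun _ _ => 0)) with (e := 1) as [F [HF _]]; [intros; lra|lra|].
      exists F. split; [exact HF|]. simpl.
      replace (2 * BB / (0 + 1)) with (2 * BB) by field.
      apply Rle_trans with (BB - 1); [|lra]. unfold BB, Phi.
      replace (fsum n (fun _ => fsum m (fun _ => B ^ 2)) + 1 - 1)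
        with (fsum n (fun _ => fsum m (fun _ => B ^ 2))) by ring.
      apply fsum_le; intros i Hi; apply fsum_le; intros j Hj.
      eapply Rle_trans; [|apply (Hsq F i j); easy].
      unfold Rmax. destruct (Rle_dec 0 (q F i j)); [lra|].
      rewrite pow_i by lia. apply pow2_ge_0.
    - set (s := / (INR k + 2)).
      assert (Hk : 0 <= INR k) by apply pos_INR.
      assert (Hs0 : 0 < s) by (apply Rinv_0_lt_compat; lra).
      assert (Hs1 : s <= 1).
      { unfold s. rewrite <- Rinv_1. apply Rinv_le_contravar; lra. }
      (* With this tolerance the cross term costs at most [s^2 BB], and the square term at most
         another [s^2 BB]. *)
      destruct (Hdual (fun i j => Rmax 0 (q F i j))) with (e := s * BB / 2)
        as [G [HG HGe]]; [intros; apply Rmax_l|nra|].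
      destruct (Hconv s F G) as [HM HMq]; [lra|easy|easy|].
      exists (mix s F G). split; [exact HM|].
      apply Rle_trans with
        (fsum n (fun i => fsum m (fun j =>
           (1 - s) ^ 2 * Rmax 0 (q F i j) ^ 2
           + (2 * s * (1 - s) * (Rmax 0 (q F i j) * q G i j) + s ^ 2 * B ^ 2)))).
      { apply fsum_le; intros i Hi; apply fsum_le; intros j Hj.
        assert (A := HMq i j Hi Hj). assert (C := Hsq G i j HG Hi Hj).
        set (x := q F i j) in *. set (y := q G i j) in *. set (z := q (mix s F G) i j) in *.
        assert (X : x <= Rmax 0 x) by apply Rmax_r.
        assert (X0 : 0 <= Rmax 0 x) by apply Rmax_l.
        assert (D : z <= (1 - s) * Rmax 0 x + s * y) by nra.
        apply Rle_trans with (((1 - s) * Rmax 0 x + s * y) ^ 2); [|nra].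
        unfold Rmax at 1. destruct (Rle_dec 0 z); [apply pow_incr; lra|].
        rewrite pow_i by lia. apply pow2_ge_0. }
      rewrite (fsum_ext _ _ (fun i =>
        (1 - s) ^ 2 * fsum m (fun j => Rmax 0 (q F i j) ^ 2) +
        (2 * s * (1 - s) * fsum m (fun j => Rmax 0 (q F i j) * q G i j)
         + s ^ 2 * fsum m (fun j => B ^ 2))))
        by (intros; now rewrite !fsum_plus, !fsum_scal).
      rewrite !fsum_plus, !fsum_scal. fold (Phi F).
      set (D := fsum n (fun i => fsum m (fun j => Rmax 0 (q F i j) * q G i j))) in *.
      replace (fsum n (fun _ => fsum m (fun _ => B ^ 2))) with (BB - 1) by (unfold BB; ring).
      assert (Es : s * (INR k + 2) = 1) by (unfold s; field; lra).
      rewrite S_INR.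
      (* The recursion that the step size [1/(k+2)] solves exactly. *)
      replace (2 * BB / (INR k + 1 + 1))
        with ((1 - s) ^ 2 * (2 * BB / (INR k + 1)) + 2 * s ^ 2 * BB)
        by (unfold s; field; lra).
      assert ((1 - s) ^ 2 * Phi F <= (1 - s) ^ 2 * (2 * BB / (INR k + 1)))
        by (apply Rmult_le_compat_l; [apply pow2_ge_0|easy]).
      assert (2 * s * (1 - s) * D <= 2 * s * (1 - s) * (s * BB / 2))
        by (apply Rmult_le_compat_l; [nra|easy]).
      assert (0 <= s ^ 3 * BB) by (apply Rmult_le_pos; [apply pow_le; lra|lra]).
      nra. }
  destruct (archimed_cor1 (e ^ 2 / (2 * BB))) as [N [HN HN0]].
  { apply Rdiv_lt_0_compat; nra. }
  destruct (Step N) as [F [HF HPhi]].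
  exists F. split; [easy|]. intros i j Hi Hj.
  assert (T : Rmax 0 (q F i j) ^ 2 <= Phi F).
  { apply Rle_trans with (fsum m (fun j => Rmax 0 (q F i j) ^ 2)).
    - apply (fsum_term_le m (fun j => Rmax 0 (q F i j) ^ 2)); [|easy].
      intros; apply pow2_ge_0.
    - apply (fsum_term_le n (fun i => fsum m (fun j => Rmax 0 (q F i j) ^ 2))); [|easy].
      intros; apply fsum_nonneg; intros; apply pow2_ge_0. }
  assert (U : 2 * BB / (INR N + 1) <= e ^ 2).
  { assert (0 < INR N) by (apply lt_0_INR; lia).
    apply Rle_trans with (2 * BB * / INR N).
    - apply Rmult_le_compat_l; [lra|]. apply Rinv_le_contravar; lra.
    - apply Rlt_le in HN. apply (Rmult_le_compat_l (2 * BB)) in HN; [|lra].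
      replace (2 * BB * (e ^ 2 / (2 * BB))) with (e ^ 2) in HN by (field; lra). easy. }
  assert (X : q F i j <= Rmax 0 (q F i j)) by apply Rmax_r.
  assert (X0 : 0 <= Rmax 0 (q F i j)) by apply Rmax_l. nra.
Qed.

(** * Resolvents of a weighted graph *)

Section Resolvent.

(* [lazy_walk] is [I - kappa G^-1 Lap], reversible with respect to [G]; its resolvent
   [(1 - alpha) (I - alpha lazy_walk)^-1] with [alpha = 1 / (1 + kappa)] solves
   [G F + Lap F = G f].  [resolvent N] stops the geometric time at [N]. *)
Variables (n : nat) (G : nat -> R) (W : nat -> nat -> R) (kappa : R).
Hypothesis n_pos : (0 < n)%nat.
Hypothesis G_pos : forall i, (i < n)%nat -> 0 < G i.
Hypothesis W_nonneg : forall i j, 0 <= W i j.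
Hypothesis W_sym : forall i j, W i j = W j i.
Hypothesis kappa_pos : 0 < kappa.
Hypothesis kappa_small : forall i, (i < n)%nat -> kappa * fsum n (W i) <= G i.

Definition lazy_walk (i j : nat) : R :=
  (if Nat.eqb i j then 1 else 0) * (1 - kappa * fsum n (W i) / G i) + kappa * W i j / G i.

Let mass := fsum n G.

Lemma mass_pos : 0 < mass.
Proof.
  apply Rlt_le_trans with (G 0%nat); [now apply G_pos|].
  apply (fsum_term_le n G 0); [|easy]. intros; now apply Rlt_le, G_pos.
Qed.

Lemma lazy_walk_act i y : (i < n)%nat ->
  G i * fsum n (fun j => lazy_walk i j * y j) =
  G i * y i - kappa * fsum n (fun j => W i j * (y i - y j)).
Proof.
  intros Hi. assert (Gi := G_pos i Hi).
  rewrite (fsum_ext _ (fun j => lazy_walk i j * y j)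
    (fun j => (if Nat.eqb i j then 1 else 0) * ((1 - kappa * fsum n (W i) / G i) * y j)
              + kappa / G i * (W i j * y j))).
  2:{ intros j Hj. unfold lazy_walk. field. lra. }
  rewrite fsum_plus, fsum_delta, fsum_scal by easy.
  rewrite (fsum_ext _ (fun j => W i j * (y i - y j))
    (fun j => W i j * y i - W i j * y j)) by (intros; ring).
  rewrite fsum_minus, fsum_scal_r. change (fun i0 : nat => W i i0) with (W i). field. lra.
Qed.

Lemma lazy_walk_balance i j : (i < n)%nat -> (j < n)%nat ->
  G i * lazy_walk i j = G j * lazy_walk j i.
Proof.
  intros Hi Hj. assert (Gi := G_pos i Hi). assert (Gj := G_pos j Hj).
  unfold lazy_walk. rewrite (Nat.eqb_sym j i).
  destruct (Nat.eqb_spec i j) as [->|Hne]; [reflexivity|].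
  rewrite (W_sym j i). field. lra.
Qed.

Lemma lazy_walk_sum i : (i < n)%nat -> fsum n (lazy_walk i) = 1.
Proof.
  intros Hi. assert (E := lazy_walk_act i (fun _ => 1) Hi). assert (Gi := G_pos i Hi).
  rewrite (fsum_ext _ (fun j => lazy_walk i j * 1) (lazy_walk i)) in E by (intros; ring).
  rewrite (fsum_ext _ (fun j => W i j * (1 - 1)) (fun _ => 0)) in E by (intros; ring).
  rewrite fsum_zero in E. nra.
Qed.

Lemma lazy_walk_stationary :
  stationary_reversible n lazy_walk (fun i => G i / mass).
Proof.
  assert (Hm := mass_pos).
  assert (Bal : forall i j, (i < n)%nat -> (j < n)%nat ->
            G i / mass * lazy_walk i j = G j / mass * lazy_walk j i).
  { intros i j Hi Hj. assert (E := lazy_walk_balance i j Hi Hj).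
    unfold Rdiv. rewrite !(Rmult_comm _ (/ mass)), !Rmult_assoc. now rewrite E. }
  repeat split.
  - intros i j Hi Hj. assert (Gi := G_pos i Hi). unfold lazy_walk.
    apply Rplus_le_le_0_compat.
    + apply Rmult_le_pos; [destruct Nat.eqb; lra|].
      assert (kappa * fsum n (W i) / G i <= 1); [|lra].
      apply (Rmult_le_reg_r (G i)); [easy|]. unfold Rdiv.
      rewrite Rmult_assoc, Rinv_l, Rmult_1_r, Rmult_1_l by lra. now apply kappa_small.
    + apply Rmult_le_pos; [apply Rmult_le_pos; [lra|easy]|].
      now apply Rlt_le, Rinv_0_lt_compat.
  - intros i Hi. now apply lazy_walk_sum.
  - intros i Hi. apply Rmult_le_pos; [now apply Rlt_le, G_pos|].
    now apply Rlt_le, Rinv_0_lt_compat.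
  - unfold Rdiv. rewrite fsum_scal_r. apply Rinv_r. fold mass. lra.
  - intros j Hj. rewrite (fsum_ext _ _ (fun i => G j / mass * lazy_walk j i))
      by (intros; now apply Bal).
    now rewrite fsum_scal, (lazy_walk_sum j Hj), Rmult_1_r.
  - exact Bal.
Qed.

Let alpha := / (1 + kappa).

Lemma alpha_bounds : 0 < alpha < 1.
Proof.
  unfold alpha. split; [apply Rinv_0_lt_compat; lra|].
  rewrite <- Rinv_1. apply Rinv_lt_contravar; lra.
Qed.

Lemma alpha_kappa : alpha * kappa = 1 - alpha.
Proof. unfold alpha. field. lra. Qed.

Definition resolvent (N i j : nat) : R :=
  (1 - alpha) * fsum N (fun t => alpha ^ t * mpow n lazy_walk t i j)
  + alpha ^ N * mpow n lazy_walk N i j.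

Lemma resolvent_nonneg N i j : (i < n)%nat -> (j < n)%nat -> 0 <= resolvent N i j.
Proof.
  intros Hi Hj. assert (A := alpha_bounds).
  assert (Q : forall t, 0 <= alpha ^ t * mpow n lazy_walk t i j).
  { intros t. apply Rmult_le_pos; [apply pow_le; lra|].
    now apply (mpow_nonneg _ _ _ lazy_walk_stationary). }
  unfold resolvent. apply Rplus_le_le_0_compat; [|apply Q].
  apply Rmult_le_pos; [lra|]. now apply fsum_nonneg.
Qed.

(** Raising the cap from [N] to [N + 1] affects only the event that the geometric time exceeds [N],
    of probability [alpha ^ S N]: there the walk takes one more step. *)
Lemma resolvent_step N i j :
  resolvent (S N) i j - resolvent N i j =
  alpha ^ S N * (mpow n lazy_walk (S N) i j - mpow n lazy_walk N i j).
Proof. unfold resolvent. cbn [fsum pow]. ring. Qed.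

Lemma resolvent_sum N i : (i < n)%nat -> fsum n (resolvent N i) = 1.
Proof.
  intros Hi. induction N as [|N IH].
  - rewrite (fsum_ext _ _ (mpow n lazy_walk 0 i)).
    + now apply (mpow_sum _ _ _ lazy_walk_stationary).
    + intros j Hj. unfold resolvent. simpl. ring.
  - rewrite (fsum_ext _ _ (fun j => resolvent N i j +
      alpha ^ S N * (mpow n lazy_walk (S N) i j - mpow n lazy_walk N i j)))
      by (intros; rewrite <- resolvent_step; ring).
    rewrite fsum_plus, fsum_scal, fsum_minus, IH.
    rewrite !(mpow_sum _ _ _ lazy_walk_stationary) by easy. ring.
Qed.

Lemma resolvent_balance N i j : (i < n)%nat -> (j < n)%nat ->
  G i * resolvent N i j = G j * resolvent N j i.
Proof.
  intros Hi Hj. assert (Hm := mass_pos).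
  assert (Q : forall t, G i * mpow n lazy_walk t i j = G j * mpow n lazy_walk t j i).
  { intros t. assert (E := mpow_reversible _ _ _ lazy_walk_stationary t i j Hi Hj).
    cbn beta in E. apply (Rmult_eq_reg_l (/ mass)); [|apply Rinv_neq_0_compat; lra].
    unfold Rdiv in E. lra. }
  induction N as [|N IH].
  - assert (E := Q 0%nat). unfold resolvent. simpl in *. lra.
  - assert (E := Q (S N)). assert (E' := Q N).
    replace (resolvent (S N) i j) with (resolvent N i j +
      alpha ^ S N * (mpow n lazy_walk (S N) i j - mpow n lazy_walk N i j))
      by (rewrite <- resolvent_step; ring).
    replace (resolvent (S N) j i) with (resolvent N j i +
      alpha ^ S N * (mpow n lazy_walk (S N) j i - mpow n lazy_walk N j i))
      by (rewrite <- resolvent_step; ring).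
    rewrite !Rmult_plus_distr_l, IH. f_equal.
    transitivity (alpha ^ S N *
      (G i * mpow n lazy_walk (S N) i j - G i * mpow n lazy_walk N i j)); [ring|].
    rewrite E, E'. ring.
Qed.

(** The geometric time is either 0 or, by lack of memory, one step followed by a fresh geometric
    time. The cap drops by one, so the resolvent equation holds up to the change from [N] to
    [S N]. *)
Lemma resolvent_succ N i j : (i < n)%nat -> (j < n)%nat ->
  resolvent (S N) i j = (1 - alpha) * (if Nat.eqb i j then 1 else 0)
    + alpha * fsum n (fun k => lazy_walk i k * resolvent N k j).
Proof.
  intros Hi Hj. induction N as [|N IH].
  - rewrite (fsum_ext _ _ (fun k => lazy_walk i k * mpow n lazy_walk 0 k j)).
    + rewrite <- mpow_succ_left by easy. unfold resolvent. simpl. ring.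
    + intros k Hk. unfold resolvent. simpl. ring.
  - replace (resolvent (S (S N)) i j) with (resolvent (S N) i j +
      alpha ^ S (S N) * (mpow n lazy_walk (S (S N)) i j - mpow n lazy_walk (S N) i j))
      by (rewrite <- resolvent_step; ring).
    rewrite (fsum_ext _ (fun k => lazy_walk i k * resolvent (S N) k j)
      (fun k => lazy_walk i k * resolvent N k j + alpha ^ S N *
        (lazy_walk i k * mpow n lazy_walk (S N) k j
         - lazy_walk i k * mpow n lazy_walk N k j))).
    2:{ intros k Hk. replace (resolvent (S N) k j) with (resolvent N k j +
          alpha ^ S N * (mpow n lazy_walk (S N) k j - mpow n lazy_walk N k j))
          by (rewrite <- resolvent_step; ring). ring. }
    rewrite fsum_plus, fsum_scal, fsum_minus, <- !mpow_succ_left by easy.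
    rewrite IH. cbn [pow]. ring.
Qed.

(** The left side is the mean of the capped geometric time, and [/ kappa] is the mean without the
    cap. *)
Lemma stopped_geometric_mean N :
  (1 - alpha) * fsum N (fun t => INR t * alpha ^ t) + INR N * alpha ^ N <= / kappa.
Proof.
  assert (A := alpha_bounds). assert (AK := alpha_kappa).
  (* The mean is the sum of the tail probabilities [alpha ^ t] for [t] from 1 to [N]. *)
  assert (E : (1 - alpha) * ((1 - alpha) * fsum N (fun t => INR t * alpha ^ t)
                             + INR N * alpha ^ N) = alpha * (1 - alpha ^ N)).
  { induction N as [|N IH]; [simpl; ring|].
    rewrite S_INR. cbn [fsum pow].
    replace (fsum N (fun t => INR t * alpha ^ t)) with
      ((alpha * (1 - alpha ^ N) / (1 - alpha) - INR N * alpha ^ N) / (1 - alpha)).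
    - field. lra.
    - rewrite <- IH. field. lra. }
  apply (Rmult_le_reg_l (1 - alpha)); [lra|]. rewrite E, <- AK.
  rewrite Rmult_assoc, Rinv_r by lra.
  assert (0 <= alpha ^ N) by (apply pow_le; lra). nra.
Qed.

(** At time [t] Markov type gives [M^2 t] times the one-step energy, which is [kappa] times the
    weighted energy on the right. Averaging [t] over the capped geometric time costs at most
    [/ kappa], so [kappa] cancels; [mass] only undoes the normalisation of the stationary law. *)
Lemma resolvent_dispersion (d : nat -> nat -> R) (M : R) N :
  (forall i, d i i = 0) ->
  (forall P pi, stationary_reversible n P pi -> forall t,
     fsum n (fun i => fsum n (fun j => pi i * mpow n P t i j * d i j ^ 2))
     <= M ^ 2 * INR t * fsum n (fun i => fsum n (fun j => pi i * P i j * d i j ^ 2))) ->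
  fsum n (fun i => fsum n (fun j => G i * resolvent N i j * d i j ^ 2))
  <= M ^ 2 * fsum n (fun i => fsum n (fun j => W i j * d i j ^ 2)).
Proof.
  intros d0 HM. assert (Hm := mass_pos). assert (A := alpha_bounds).
  set (E := fsum n (fun i => fsum n (fun j => W i j * d i j ^ 2))).
  set (T := fun t => fsum n (fun i => fsum n (fun j =>
              G i * mpow n lazy_walk t i j * d i j ^ 2))).
  assert (HE : 0 <= E).
  { apply fsum_nonneg; intros; apply fsum_nonneg; intros.
    apply Rmult_le_pos; [easy|apply pow2_ge_0]. }
  assert (HT : forall t, T t <= M ^ 2 * kappa * E * INR t).
  { intros t. specialize (HM _ _ lazy_walk_stationary t). cbn beta in HM.
    apply (Rmult_le_compat_l mass) in HM; [|lra].
    rewrite <- fsum_scal in HM.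
    rewrite (fsum_ext _ _ (fun i => fsum n (fun j =>
              G i * mpow n lazy_walk t i j * d i j ^ 2))) in HM.
    2:{ intros i Hi. rewrite <- fsum_scal. apply fsum_ext. intros j Hj. field. lra. }
    fold (T t) in HM. eapply Rle_trans; [exact HM|]. apply Req_le.
    replace (fsum n (fun i => fsum n (fun j => G i / mass * lazy_walk i j * d i j ^ 2)))
      with (kappa / mass * E); [field; lra|].
    unfold E. rewrite <- fsum_scal. apply fsum_ext. intros i Hi.
    rewrite <- fsum_scal. apply fsum_ext. intros j Hj. unfold lazy_walk.
    assert (Gi := G_pos i Hi).
    (* The holding probability of the walk is invisible to [d], which vanishes on the diagonal. *)
    destruct (Nat.eqb_spec i j) as [<-|Hne]; [rewrite d0|]; field; lra. }
  assert (Split : fsum n (fun i => fsum n (fun j => G i * resolvent N i j * d i j ^ 2))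
    = (1 - alpha) * fsum N (fun t => alpha ^ t * T t) + alpha ^ N * T N).
  { induction N as [|N IH].
    - simpl. rewrite Rmult_0_r, Rplus_0_l, Rmult_1_l. unfold T.
      apply fsum_ext; intros i Hi; apply fsum_ext; intros j Hj.
      unfold resolvent. simpl. ring.
    - rewrite (fsum_ext _ _ (fun i =>
        fsum n (fun j => G i * resolvent N i j * d i j ^ 2) + alpha ^ S N *
        (fsum n (fun j => G i * mpow n lazy_walk (S N) i j * d i j ^ 2)
         - fsum n (fun j => G i * mpow n lazy_walk N i j * d i j ^ 2)))).
      2:{ intros i Hi. rewrite <- fsum_minus, <- fsum_scal, <- fsum_plus.
          apply fsum_ext. intros j Hj.
          replace (resolvent (S N) i j) with (resolvent N i j +
            alpha ^ S N * (mpow n lazy_walk (S N) i j - mpow n lazy_walk N i j))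
            by (rewrite <- resolvent_step; ring). ring. }
      rewrite fsum_plus, fsum_scal, fsum_minus, IH. fold (T (S N)). fold (T N).
      cbn [fsum pow]. ring. }
  rewrite Split.
  apply Rle_trans with (M ^ 2 * kappa * E *
    ((1 - alpha) * fsum N (fun t => INR t * alpha ^ t) + INR N * alpha ^ N)).
  - rewrite Rmult_plus_distr_l. apply Rplus_le_compat.
    + rewrite (Rmult_comm (M ^ 2 * kappa * E)), Rmult_assoc.
      apply Rmult_le_compat_l; [lra|]. rewrite <- fsum_scal_r. apply fsum_le.
      intros t _. specialize (HT t).
      assert (0 <= alpha ^ t) by (apply pow_le; lra). nra.
    + specialize (HT N). assert (0 <= alpha ^ N) by (apply pow_le; lra). nra.
  - eapply Rle_trans; [apply Rmult_le_compat_l; [|apply stopped_geometric_mean]|].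
    + apply Rmult_le_pos; [|easy]. apply Rmult_le_pos; [apply pow2_ge_0|lra].
    + apply Req_le. field. lra.
Qed.

Variable H : HilbertSpace.
Variable f : nat -> H.

Definition smoothed (N i : nat) : H :=
  vsum H n (fun j => vs_scal H (resolvent N i j) (f j)).

Lemma inner_smoothed N i w :
  hs_inner H (smoothed N i) w = fsum n (fun j => resolvent N i j * hs_inner H (f j) w).
Proof.
  unfold smoothed. rewrite inner_vsum_l. apply fsum_ext. intros; apply hs_inner_scal.
Qed.

Lemma smoothed_succ N i w : (i < n)%nat ->
  hs_inner H (smoothed (S N) i) w = (1 - alpha) * hs_inner H (f i) w
    + alpha * fsum n (fun k => lazy_walk i k * hs_inner H (smoothed N k) w).
Proof.
  intros Hi. rewrite inner_smoothed.
  rewrite (fsum_ext _ _ (fun j => (1 - alpha) *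
      ((if Nat.eqb i j then 1 else 0) * hs_inner H (f j) w)
      + alpha * fsum n (fun k => lazy_walk i k * (resolvent N k j * hs_inner H (f j) w)))).
  - rewrite fsum_plus, !fsum_scal, fsum_delta by easy. f_equal. f_equal.
    rewrite fsum_swap. apply fsum_ext. intros k Hk. rewrite inner_smoothed.
    now rewrite fsum_scal.
  - intros j Hj. rewrite resolvent_succ by easy.
    rewrite (fsum_ext _ (fun k => lazy_walk i k * (resolvent N k j * hs_inner H (f j) w))
      (fun k => lazy_walk i k * resolvent N k j * hs_inner H (f j) w)) by (intros; ring).
    rewrite fsum_scal_r. ring.
Qed.

(** Summation by parts: the symmetry of [W] turns the energy into twice the pairing of [F] with its
    Laplacian. *)
Lemma dirichlet_form F :
  fsum n (fun i => fsum n (fun j => W i j * hdist H (F i) (F j) ^ 2)) =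
  2 * fsum n (fun i => fsum n (fun j =>
        W i j * (hs_inner H (F i) (F i) - hs_inner H (F j) (F i)))).
Proof.
  set (X := fsum n (fun i => fsum n (fun j =>
        W i j * (hs_inner H (F i) (F i) - hs_inner H (F j) (F i))))).
  assert (E : X = fsum n (fun i => fsum n (fun j =>
        W i j * (hs_inner H (F j) (F j) - hs_inner H (F j) (F i))))).
  { unfold X. rewrite fsum_swap. apply fsum_ext; intros i _. apply fsum_ext; intros j _.
    now rewrite (W_sym j i), (hs_inner_sym _ (F i) (F j)). }
  replace (2 * X) with (X + X) by ring. rewrite E at 2. unfold X.
  rewrite <- fsum_plus. apply fsum_ext; intros i _.
  rewrite <- fsum_plus. apply fsum_ext; intros j _.
  rewrite hdist_sqr, (hs_inner_sym _ (F i) (F j)). ring.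
Qed.

(** Pairing [G F + Lap F = G f] with [F] reduces the energy to the sum of
    [G i (|f i|^2 - <F i, f i>)], and the symmetric averaging kernel rewrites this as a mean of
    [|f i - f j|^2]. The last term is the residual left by the cap [N]. *)
Lemma smoothed_energy N :
  fsum n (fun i => G i * hdist H (smoothed N i) (f i) ^ 2)
  + / 2 * fsum n (fun i => fsum n (fun j =>
      W i j * hdist H (smoothed N i) (smoothed N j) ^ 2))
  = / 2 * fsum n (fun i => fsum n (fun j =>
      G i * resolvent N i j * hdist H (f i) (f j) ^ 2))
  + / (1 - alpha) * fsum n (fun i => G i *
      hs_inner H (vs_sub H (smoothed N i) (smoothed (S N) i)) (smoothed N i)).
Proof.
  assert (A := alpha_bounds). assert (AK := alpha_kappa).
  set (F := smoothed N). set (F' := smoothed (S N)).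
  rewrite (dirichlet_form F).
  set (X := fun i => fsum n (fun j =>
    W i j * (hs_inner H (F i) (F i) - hs_inner H (F j) (F i)))).
  change (fsum n (fun i => fsum n (fun j =>
    W i j * (hs_inner H (F i) (F i) - hs_inner H (F j) (F i))))) with (fsum n X).
  assert (EX : forall i, (i < n)%nat -> X i = G i * hs_inner H (f i) (F i) +
    / (1 - alpha) * (G i * (alpha * hs_inner H (F i) (F i) - hs_inner H (F' i) (F i)))).
  { intros i Hi. assert (E := smoothed_succ N i (F i) Hi).
    assert (E2 := lazy_walk_act i (fun k => hs_inner H (F k) (F i)) Hi).
    cbn beta in E2. fold (X i) in E2. fold F F' in E.
    set (y := fsum n (fun k => lazy_walk i k * hs_inner H (F k) (F i))) in *.
    apply (Rmult_eq_reg_l (1 - alpha)); [|lra].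
    replace ((1 - alpha) * X i) with (alpha * (kappa * X i)) by (rewrite <- AK; ring).
    replace (kappa * X i) with (G i * hs_inner H (F i) (F i) - G i * y) by lra.
    rewrite E. field. lra. }
  assert (EY : / 2 * fsum n (fun i => fsum n (fun j =>
      G i * resolvent N i j * hdist H (f i) (f j) ^ 2)) =
      fsum n (fun i => G i * (hs_inner H (f i) (f i) - hs_inner H (F i) (f i)))).
  { set (Y := fsum n (fun i => G i * (hs_inner H (f i) (f i) - hs_inner H (F i) (f i)))).
    assert (E1 : Y = fsum n (fun i => fsum n (fun j =>
      G i * resolvent N i j * (hs_inner H (f i) (f i) - hs_inner H (f i) (f j))))).
    { apply fsum_ext. intros i Hi. unfold F. rewrite inner_smoothed.
      rewrite (fsum_ext _ (fun j => G i * resolvent N i j * _) (fun j =>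
        G i * hs_inner H (f i) (f i) * resolvent N i j
        - G i * (resolvent N i j * hs_inner H (f j) (f i)))).
      - rewrite fsum_minus, !fsum_scal, (resolvent_sum N i Hi). ring.
      - intros j _. rewrite (hs_inner_sym _ (f i) (f j)). ring. }
    assert (E2 : Y = fsum n (fun i => fsum n (fun j =>
      G i * resolvent N i j * (hs_inner H (f j) (f j) - hs_inner H (f i) (f j))))).
    { rewrite E1, fsum_swap. apply fsum_ext; intros i Hi. apply fsum_ext; intros j Hj.
      rewrite (resolvent_balance N j i Hj Hi). now rewrite (hs_inner_sym _ (f i) (f j)). }
    (* The two expressions of [Y] differ by exchanging the ends of the walk; their sum completes the
       square of [f i - f j]. *)
    replace Y with (/ 2 * (Y + Y)) by field. f_equal. rewrite E1 at 1. rewrite E2.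
    rewrite <- fsum_plus. apply fsum_ext; intros i _.
    rewrite <- fsum_plus. apply fsum_ext; intros j _. rewrite hdist_sqr. ring. }
  rewrite EY, <- Rmult_assoc, Rinv_l, Rmult_1_l by lra.
  rewrite <- fsum_scal, <- !fsum_plus. apply fsum_ext. intros i Hi.
  rewrite (EX i Hi), hdist_sqr, inner_sub_l, (hs_inner_sym _ (f i) (F i)).
  field. lra.
Qed.

Variable B : R.
Hypothesis f_bounded : forall i, (i < n)%nat -> hnorm H (f i) <= B.

Lemma kernel_average_bound (K : nat -> R) :
  (forall j, (j < n)%nat -> 0 <= K j) -> fsum n K = 1 ->
  hnorm H (vsum H n (fun j => vs_scal H (K j) (f j))) <= B.
Proof.
  intros HK K1. eapply Rle_trans; [apply hnorm_vsum|].
  rewrite <- (Rmult_1_l B), <- K1, <- fsum_scal_r. apply fsum_le. intros j Hj.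
  rewrite hnorm_scal, Rabs_pos_eq by auto. apply Rmult_le_compat_l; auto.
Qed.

Lemma smoothed_bound N i : (i < n)%nat -> hnorm H (smoothed N i) <= B.
Proof.
  intros Hi. apply kernel_average_bound; [intros; now apply resolvent_nonneg|].
  now apply (resolvent_sum N i).
Qed.

(** By [resolvent_step] the difference is [alpha ^ S N] times a difference of two averages of
    [f]. *)
Lemma smoothed_step_bound N i : (i < n)%nat ->
  hnorm H (vs_sub H (smoothed N i) (smoothed (S N) i)) <= 2 * B * alpha ^ S N.
Proof.
  intros Hi. assert (A := alpha_bounds).
  set (a := fun t => vsum H n (fun j => vs_scal H (mpow n lazy_walk t i j) (f j))).
  replace (vs_sub H (smoothed N i) (smoothed (S N) i))
    with (vs_scal H (alpha ^ S N) (vs_sub H (a N) (a (S N)))).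
  - rewrite hnorm_scal, Rabs_pos_eq by (apply pow_le; lra).
    rewrite Rmult_comm. apply Rmult_le_compat_r; [apply pow_le; lra|].
    eapply Rle_trans; [apply hnorm_sub_triangle|].
    assert (forall t, hnorm H (a t) <= B) as Ha; [|specialize (Ha N) as H1;
      specialize (Ha (S N)); lra].
    intros t. apply kernel_average_bound.
    + intros; now apply (mpow_nonneg _ _ _ lazy_walk_stationary).
    + now apply (mpow_sum _ _ _ lazy_walk_stationary).
  - apply inner_ext. intros w. rewrite hs_inner_scal, !inner_sub_l, !inner_smoothed.
    unfold a. rewrite !inner_vsum_l, <- !fsum_minus, <- fsum_scal.
    apply fsum_ext. intros j _. rewrite !hs_inner_scal, <- !Rmult_minus_distr_r.
    replace (resolvent N i j - resolvent (S N) i j)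
      with (- (resolvent (S N) i j - resolvent N i j)) by ring.
    rewrite resolvent_step. ring.
Qed.

(** In the energy formula the constant part of the bound on [f] contributes [a] times the total
    mass, since the resolvent has row sums 1, and the part in [d] is controlled by
    [resolvent_dispersion]. The factors 2 in the hypothesis absorb the [/ 2] of the energy. *)
Lemma smoothed_nearly_minimal (d : nat -> nat -> R) (M a b e : R) :
  (forall i, d i i = 0) ->
  (forall P pi, stationary_reversible n P pi -> forall t,
     fsum n (fun i => fsum n (fun j => pi i * mpow n P t i j * d i j ^ 2))
     <= M ^ 2 * INR t * fsum n (fun i => fsum n (fun j => pi i * P i j * d i j ^ 2))) ->
  0 <= b ->
  (forall i j, (i < n)%nat -> (j < n)%nat ->
     hdist H (f i) (f j) ^ 2 <= 2 * a + 2 * b * d i j ^ 2) ->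
  0 < e ->
  exists N,
  fsum n (fun i => G i * hdist H (smoothed N i) (f i) ^ 2)
  + / 2 * fsum n (fun i => fsum n (fun j =>
      W i j * hdist H (smoothed N i) (smoothed N j) ^ 2))
  <= a * fsum n G + b * M ^ 2 * fsum n (fun i => fsum n (fun j => W i j * d i j ^ 2)) + e.
Proof.
  intros d0 HM Hb Hf He. assert (A := alpha_bounds). assert (Hm := mass_pos).
  (* The residual is at most [(C - 1) * alpha ^ S N]; the added 1 makes [C] positive. *)
  set (C := 2 * B ^ 2 * mass / (1 - alpha) + 1).
  assert (HC0 : 0 <= 2 * B ^ 2 * mass / (1 - alpha)).
  { apply Rmult_le_pos; [|apply Rlt_le, Rinv_0_lt_compat; lra].
    apply Rmult_le_pos; [|lra]. assert (0 <= B ^ 2) by apply pow2_ge_0. lra. }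
  destruct (pow_lt_1_zero alpha) with (y := e / C) as [N HN].
  { rewrite Rabs_pos_eq; lra. }
  { apply Rdiv_lt_0_compat; [easy|unfold C; lra]. }
  exists N. rewrite smoothed_energy. apply Rplus_le_compat.
  - apply Rle_trans with (/ 2 * fsum n (fun i => fsum n (fun j =>
      2 * a * G i * resolvent N i j + 2 * b * (G i * resolvent N i j * d i j ^ 2)))).
    + apply Rmult_le_compat_l; [lra|].
      apply fsum_le; intros i Hi; apply fsum_le; intros j Hj.
      assert (0 <= G i * resolvent N i j).
      { apply Rmult_le_pos; [now apply Rlt_le, G_pos|now apply resolvent_nonneg]. }
      specialize (Hf i j Hi Hj). nra.
    + rewrite (fsum_ext _ _ (fun i => 2 * a * G i + 2 * b *
        fsum n (fun j => G i * resolvent N i j * d i j ^ 2))).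
      * rewrite fsum_plus, !fsum_scal.
        assert (Q := resolvent_dispersion d M N d0 HM).
        change (fun i : nat => G i) with G. nra.
      * intros i Hi. rewrite fsum_plus, !fsum_scal, (resolvent_sum N i Hi). ring.
  - apply Rle_trans with (/ (1 - alpha) * fsum n (fun i => G i * (2 * B * alpha ^ S N * B))).
    + apply Rmult_le_compat_l; [apply Rlt_le, Rinv_0_lt_compat; lra|].
      apply fsum_le; intros i Hi. apply Rmult_le_compat_l; [now apply Rlt_le, G_pos|].
      eapply Rle_trans; [apply cauchy_schwarz|].
      apply Rmult_le_compat; try apply hnorm_nonneg;
        [now apply smoothed_step_bound|now apply smoothed_bound].
    + rewrite fsum_scal_r. fold mass.
      replace (/ (1 - alpha) * (mass * (2 * B * alpha ^ S N * B)))
        with ((C - 1) * alpha ^ S N) by (unfold C; field; lra).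
      specialize (HN (S N)). rewrite Rabs_pos_eq in HN by (apply pow_le; lra).
      assert (X : alpha ^ S N < e / C) by (apply HN; lia).
      assert (0 <= alpha ^ S N) by (apply pow_le; lra).
      apply (Rmult_lt_compat_l C) in X; [|unfold C; lra].
      replace (C * (e / C)) with e in X by (field; unfold C; lra). lra.
Qed.

End Resolvent.

(** * Lipschitz smoothing *)

(** The defect in the inequality is [s (1 - s) |x - y|^2]. *)
Lemma hnorm_sqr_convex (H : HilbertSpace) (s : R) (x y : H) : 0 <= s <= 1 ->
  hnorm H (vs_add H (vs_scal H (1 - s) x) (vs_scal H s y)) ^ 2
  <= (1 - s) * hnorm H x ^ 2 + s * hnorm H y ^ 2.
Proof.
  intros Hs. rewrite !hnorm_sqr.
  assert (Q := hs_inner_pos H (vs_sub H x y)).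
  rewrite !inner_sub_l, !inner_sub_r, (hs_inner_sym _ y x) in Q.
  rewrite !hs_inner_add, !inner_add_r, !hs_inner_scal, !inner_scal_r, (hs_inner_sym _ y x).
  assert (0 <= s * (1 - s)) by nra. nra.
Qed.

Lemma fsum_symmetrize n (h : nat -> nat -> R) (u : nat -> nat -> R) :
  (forall i j, u i j = u j i) ->
  fsum n (fun i => fsum n (fun j => (h i j + h j i) * u i j)) =
  2 * fsum n (fun i => fsum n (fun j => h i j * u i j)).
Proof.
  intros Sym.
  rewrite (fsum_ext _ _ (fun i => fsum n (fun j => h i j * u i j)
    + fsum n (fun j => h j i * u j i))).
  - rewrite fsum_plus, (fsum_swap n n (fun i j => h j i * u j i)). ring.
  - intros i _. rewrite <- fsum_plus. apply fsum_ext. intros j _. rewrite (Sym j i). ring.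
Qed.

Lemma finite_smoothing (H : HilbertSpace) (n : nat) (d : nat -> nat -> R) (f : nat -> H)
  (M a b : R) :
  (forall i, d i i = 0) -> (forall i j, d i j = d j i) ->
  (forall P pi, stationary_reversible n P pi -> forall t,
     fsum n (fun i => fsum n (fun j => pi i * mpow n P t i j * d i j ^ 2))
     <= M ^ 2 * INR t * fsum n (fun i => fsum n (fun j => pi i * P i j * d i j ^ 2))) ->
  0 <= b ->
  (forall i j, (i < n)%nat -> (j < n)%nat ->
     hdist H (f i) (f j) ^ 2 <= 2 * a + 2 * b * d i j ^ 2) ->
  forall e, 0 < e ->
  exists F : nat -> H,
    (forall i, (i < n)%nat -> hdist H (F i) (f i) ^ 2 <= a + e) /\
    (forall i j, (i < n)%nat -> (j < n)%nat ->
       hdist H (F i) (F j) ^ 2 <= 2 * b * M ^ 2 * d i j ^ 2 + e).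
Proof.
  intros d0 dsym HM Hb Hf e He.
  destruct (Nat.eq_dec n 0) as [->|Hn0]; [exists f; split; intros; lia|].
  assert (Hn : (0 < n)%nat) by lia.
  set (B := fsum n (fun i => hnorm H (f i))).
  assert (HB : 0 <= B) by (apply fsum_nonneg; intros; apply hnorm_nonneg).
  assert (HfB : forall i, (i < n)%nat -> hnorm H (f i) <= B).
  { intros i Hi. apply (fsum_term_le n (fun i => hnorm H (f i))); [|easy].
    intros; apply hnorm_nonneg. }
  set (D := fsum n (fun i => fsum n (fun j => d i j ^ 2))).
  assert (HdD : forall i j, (i < n)%nat -> (j < n)%nat -> d i j ^ 2 <= D).
  { intros i j Hi Hj. apply Rle_trans with (fsum n (fun j => d i j ^ 2)).
    - apply (fsum_term_le n (fun j => d i j ^ 2)); [|easy]. intros; apply pow2_ge_0.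
    - apply (fsum_term_le n (fun i => fsum n (fun j => d i j ^ 2))); [|easy].
      intros; apply fsum_nonneg; intros; apply pow2_ge_0. }
  (* The extra column [j = n] holds the closeness constraints and the columns below [n] the
     Lipschitz constraints, hence [S n] columns. *)
  set (q := fun (F : nat -> H) (i j : nat) =>
    if Nat.eqb j n then hdist H (F i) (f i) ^ 2 - a
    else hdist H (F i) (F j) ^ 2 - 2 * b * M ^ 2 * d i j ^ 2).
  set (mix := fun (s : R) (F G : nat -> H) (i : nat) =>
    vs_add H (vs_scal H (1 - s) (F i)) (vs_scal H s (G i))).
  (* Confining [F] to the ball of radius [B] bounds the constraints; averages of [f] stay in that
     ball. *)
  destruct (convex_minimax (nat -> H) (fun F => forall i, (i < n)%nat -> hnorm H (F i) <= B)
    mix n (S n) q (4 * B ^ 2 + Rabs a + 2 * b * M ^ 2 * D)) with (e := e)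
    as [F [_ HF]]; [| | |exact He|].
  - intros s F G Hs HF HG. split.
    + intros i Hi. unfold mix. eapply Rle_trans; [apply hnorm_triangle|].
      rewrite !hnorm_scal, !Rabs_pos_eq by lra.
      specialize (HF i Hi). specialize (HG i Hi). nra.
    + intros i j Hi Hj. unfold q. destruct (Nat.eqb_spec j n) as [Ej|Ej].
      * assert (Q := hnorm_sqr_convex H s (vs_sub H (F i) (f i)) (vs_sub H (G i) (f i)) Hs).
        unfold hdist.
        replace (vs_sub H (mix s F G i) (f i)) with
          (vs_add H (vs_scal H (1 - s) (vs_sub H (F i) (f i)))
                    (vs_scal H s (vs_sub H (G i) (f i)))); [lra|].
        apply inner_ext. intros w. unfold mix.
        rewrite inner_sub_l, !hs_inner_add, !hs_inner_scal, !inner_sub_l. ring.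
      * assert (Q := hnorm_sqr_convex H s (vs_sub H (F i) (F j)) (vs_sub H (G i) (G j)) Hs).
        unfold hdist.
        replace (vs_sub H (mix s F G i) (mix s F G j)) with
          (vs_add H (vs_scal H (1 - s) (vs_sub H (F i) (F j)))
                    (vs_scal H s (vs_sub H (G i) (G j)))); [lra|].
        apply inner_ext. intros w. unfold mix.
        rewrite inner_sub_l, !hs_inner_add, !hs_inner_scal, !inner_sub_l. ring.
  - intros F i j HF Hi Hj.
    assert (Two : forall x y : H, hnorm H x <= B -> hnorm H y <= B ->
              0 <= hdist H x y ^ 2 <= 4 * B ^ 2).
    { intros x y Hx Hy. split; [apply pow2_ge_0|].
      replace (4 * B ^ 2) with ((2 * B) ^ 2) by ring. apply pow_incr.
      split; [apply hdist_nonneg|]. eapply Rle_trans; [apply hnorm_sub_triangle|lra]. }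
    assert (Hc : 0 <= 2 * b * M ^ 2) by (apply Rmult_le_pos; [lra|apply pow2_ge_0]).
    assert (HD : 0 <= D)
      by (eapply Rle_trans; [apply pow2_ge_0|apply (HdD 0%nat 0%nat Hn Hn)]).
    assert (0 <= 2 * b * M ^ 2 * D) by now apply Rmult_le_pos.
    assert (- Rabs a <= a <= Rabs a).
    { split; [|apply Rle_abs]. assert (X := Rle_abs (- a)). rewrite Rabs_Ropp in X. lra. }
    unfold q. apply Rabs_le. destruct (Nat.eqb_spec j n) as [Ej|Ej].
    + destruct (Two (F i) (f i)); auto. lra.
    + assert (Hj' : (j < n)%nat) by lia. destruct (Two (F i) (F j)); auto.
      assert (2 * b * M ^ 2 * d i j ^ 2 <= 2 * b * M ^ 2 * D)
        by (apply Rmult_le_compat_l; auto).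
      assert (0 <= 2 * b * M ^ 2 * d i j ^ 2) by (apply Rmult_le_pos; [lra|apply pow2_ge_0]).
      lra.
  - intros h Hh e' He'.
    (* The weights [h i n] may vanish, but the resolvent needs [G] positive. Adding [theta] costs at
       most half of [e'], and the truncation of the resolvent gets the other half. *)
    set (theta := e' / (2 * (INR n * Rabs a + 1))).
    assert (Hna : 0 <= INR n * Rabs a) by (apply Rmult_le_pos; [apply pos_INR|apply Rabs_pos]).
    assert (Ht : 0 < theta) by (apply Rdiv_lt_0_compat; lra).
    set (G := fun i => h i n + theta).
    (* Dual weights need not be symmetric; symmetrising doubles the sums, which the [/ 2] in the
       energy absorbs. *)
    set (W := fun i j => h i j + h j i).
    assert (HW : forall i j, 0 <= W i j).
    { intros i j. assert (A := Hh i j). assert (A' := Hh j i). unfold W. lra. }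
    set (WW := fsum n (fun i => fsum n (W i))).
    assert (HWW : forall i, (i < n)%nat -> fsum n (W i) <= WW).
    { intros i Hi. apply (fsum_term_le n (fun i => fsum n (W i))); [|easy].
      intros; now apply fsum_nonneg. }
    assert (HWW0 : 0 <= WW) by (apply fsum_nonneg; intros; now apply fsum_nonneg).
    (* Small enough that [kappa] times any row sum of [W] stays below [theta], hence below [G]. *)
    set (kappa := theta / (1 + WW)).
    assert (Hk : 0 < kappa) by (apply Rdiv_lt_0_compat; lra).
    assert (HG : forall i, (i < n)%nat -> 0 < G i).
    { intros i _. assert (A := Hh i n). unfold G. lra. }
    assert (Hks : forall i, (i < n)%nat -> kappa * fsum n (W i) <= G i).
    { intros i Hi. assert (A := Hh i n). specialize (HWW i Hi).
      apply Rle_trans with theta; [|unfold G; lra].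
      apply Rle_trans with (kappa * (1 + WW)); [apply Rmult_le_compat_l; lra|].
      apply Req_le. unfold kappa. field. lra. }
    assert (Sym : forall i j, W i j = W j i) by (intros; unfold W; ring).
    destruct (smoothed_nearly_minimal n G W kappa Hn HG HW Sym Hk Hks H f B HfB
      d M a b (e' / 2) d0 HM Hb Hf) as [N HN]; [lra|].
    set (F := smoothed n G W kappa H f N) in *.
    exists F. split.
    { intros i Hi. now apply (smoothed_bound n G W kappa Hn HG HW Sym Hk Hks H f B). }
    cbn [fsum].
    rewrite (fsum_ext _ _ (fun i =>
      (fsum n (fun j => h i j * hdist H (F i) (F j) ^ 2)
       - 2 * b * M ^ 2 * fsum n (fun j => h i j * d i j ^ 2))
      + (G i * hdist H (F i) (f i) ^ 2 - a * G i
         + theta * (a - hdist H (F i) (f i) ^ 2)))).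
    2:{ intros i Hi. f_equal.
        - rewrite <- fsum_scal, <- fsum_minus. apply fsum_ext. intros j Hj.
          unfold q. destruct (Nat.eqb_spec j n); [lia|]. ring.
        - unfold q. rewrite Nat.eqb_refl. unfold G. ring. }
    rewrite !fsum_plus, !fsum_minus, !fsum_scal.
    unfold W in HN.
    rewrite (fsum_symmetrize n h (fun i j => hdist H (F i) (F j) ^ 2)) in HN
      by (intros; now rewrite hdist_sym).
    rewrite (fsum_symmetrize n h (fun i j => d i j ^ 2)) in HN by (intros; now rewrite dsym).
    assert (T : theta * fsum n (fun i => a - hdist H (F i) (f i) ^ 2) <= e' / 2).
    { apply Rle_trans with (theta * fsum n (fun _ => Rabs a)).
      - apply Rmult_le_compat_l; [lra|]. apply fsum_le. intros i _.
        assert (0 <= hdist H (F i) (f i) ^ 2) by apply pow2_ge_0.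
        assert (X := Rle_abs a). lra.
      - rewrite fsum_const.
        apply Rle_trans with (theta * (INR n * Rabs a + 1));
          [apply Rmult_le_compat_l; lra|].
        apply Req_le. unfold theta. field. lra. }
    change (fun i : nat => G i) with G. lra.
  - exists F. split.
    + intros i Hi. specialize (HF i n Hi (Nat.lt_succ_diag_r n)).
      unfold q in HF. rewrite Nat.eqb_refl in HF. lra.
    + intros i j Hi Hj. specialize (HF i j Hi (Nat.lt_lt_succ_r _ _ Hj)).
      unfold q in HF. destruct (Nat.eqb_spec j n); [lia|lra].
Qed.

(** * Ultrafilters and weak limits in Hilbert space *)

Lemma exists_ultrafilter (I : Type) (F : (I -> Prop) -> Prop) :
  F (fun _ => True) -> ~ F (fun _ => False) ->
  (forall A B : I -> Prop, F A -> F B -> F (fun i => A i /\ B i)) ->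
  (forall A B : I -> Prop, (forall i, A i -> B i) -> F A -> F B) ->
  exists U : (I -> Prop) -> Prop,
    (forall A : I -> Prop, F A -> U A) /\
    (forall A : I -> Prop, U A -> exists i, A i) /\
    (forall A B : I -> Prop, U A -> U B -> U (fun i => A i /\ B i)) /\
    (forall A B : I -> Prop, (forall i, A i -> B i) -> U A -> U B) /\
    (forall A : I -> Prop, U A \/ U (fun i => ~ A i)).
Proof.
  intros FT F0 FI FS.
  destruct (@filter.ultraFilterLemma I F) as [U [HU HFU]].
  { constructor; [exact F0|constructor; [exact FT|exact FI|exact FS]]. }
  destruct (filter.ultra_proper (UltraFilter := HU)) as [U0 [UT UI US]].
  exists U. split; [exact HFU|]. split; [|split; [exact UI|split; [exact US|]]].
  - intros A HA. apply NNPP. intros No. apply U0.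
    apply (US A); [|exact HA]. intros i Hi. apply No. now exists i.
  - intros A. exact (filter.in_ultra_setVsetC A HU).
Qed.

Section UltrafilterLimit.

Variables (I : Type) (U : (I -> Prop) -> Prop).
Hypothesis U_ex : forall A : I -> Prop, U A -> exists i, A i.
Hypothesis U_and : forall A B : I -> Prop, U A -> U B -> U (fun i => A i /\ B i).
Hypothesis U_mono : forall A B : I -> Prop, (forall i, A i -> B i) -> U A -> U B.
Hypothesis U_ultra : forall A : I -> Prop, U A \/ U (fun i => ~ A i).

(** The limit is the supremum of the levels that [r] exceeds on a set of [U]. Membership of a
    complement is what bounds [r] from above near it. *)
Lemma ultra_limit (r : I -> R) (c : R) : U (fun i => Rabs (r i) <= c) ->
  exists l, forall e, 0 < e -> U (fun i => Rabs (r i - l) < e).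
Proof.
  intros Hc.
  destruct (completeness (fun x => U (fun i => x <= r i))) as [l [Ub Lub]].
  - exists c. intros x Hx. destruct (U_ex _ (U_and _ _ Hc Hx)) as [i [A B]].
    assert (D := Rle_abs (r i)). lra.
  - exists (- c). apply (U_mono (fun i => Rabs (r i) <= c)); [|exact Hc].
    intros i Hi. assert (D := Rle_abs (- r i)). rewrite Rabs_Ropp in D. lra.
  - exists l. intros e He.
    assert (A : exists x, U (fun i => x <= r i) /\ l - e < x).
    { apply NNPP. intros No. assert (l <= l - e); [|lra]. apply Lub. intros x Hx.
      apply Rnot_lt_le. intros Lt. apply No. now exists x. }
    destruct A as [x [Hx Hlx]].
    assert (B : U (fun i => ~ l + e / 2 <= r i)).
    { destruct (U_ultra (fun i => l + e / 2 <= r i)) as [Q|Q]; [|exact Q].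
      assert (l + e / 2 <= l) by (apply Ub; exact Q). lra. }
    apply (U_mono (fun i => x <= r i /\ ~ l + e / 2 <= r i)); [|now apply U_and].
    intros i [Q1 Q2]. apply Rabs_def1; lra.
Qed.

Definition weak_limit (H : HilbertSpace) (u : I -> H) (v : H) : Prop :=
  forall w e, 0 < e -> U (fun i => Rabs (hs_inner H (u i) w - hs_inner H v w) < e).

(** Limits along [U] of [inner (u i) w] are linear and bounded in [w], so Riesz represents them by a
    vector. *)
Lemma ultra_weak_limit (H : HilbertSpace) (u : I -> H) (c : R) :
  U (fun i => hnorm H (u i) <= c) -> exists v, weak_limit H u v.
Proof.
  intros Hc.
  assert (c0 : 0 <= c).
  { destruct (U_ex _ Hc) as [i Hi]. assert (N := hnorm_nonneg H (u i)). lra. }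
  assert (Ex : forall w, exists l, forall e, 0 < e ->
            U (fun i => Rabs (hs_inner H (u i) w - l) < e)).
  { intros w. apply ultra_limit with (c := c * hnorm H w).
    apply (U_mono (fun i => hnorm H (u i) <= c)); [|exact Hc]. intros i Hi.
    eapply Rle_trans; [apply cauchy_schwarz_abs|].
    apply Rmult_le_compat_r; [apply hnorm_nonneg|easy]. }
  destruct (choice _ Ex) as [l Hl].
  assert (Close : forall x y, (forall e, 0 < e -> Rabs (x - y) <= e) -> x = y).
  { intros x y E. apply Rminus_diag_uniq, cond_eq. intros e He. rewrite Rminus_0_r.
    specialize (E (e / 2)). lra. }
  destruct (riesz H l c c0) as [v Hv].
  - intros x y. apply Close. intros e He.
    assert (He3 : 0 < e / 3) by lra.
    destruct (U_ex _ (U_and _ _ (Hl x _ He3) (U_and _ _ (Hl y _ He3)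
      (Hl (vs_add H x y) _ He3)))) as [i (A & B & C)].
    rewrite inner_add_r in C. apply Rabs_def2 in A, B, C. apply Rabs_le. lra.
  - intros s x. apply Close. intros e He.
    assert (Hs : 0 < Rabs s + 1) by (assert (Q := Rabs_pos s); lra).
    assert (He2 : 0 < e / 2 / (Rabs s + 1)) by (apply Rdiv_lt_0_compat; lra).
    assert (He2' : 0 < e / 2) by lra.
    destruct (U_ex _ (U_and _ _ (Hl x _ He2) (Hl (vs_scal H s x) _ He2'))) as [i (A & B)].
    rewrite inner_scal_r in B.
    replace (l (vs_scal H s x) - s * l x) with
      (- (s * hs_inner H (u i) x - l (vs_scal H s x)) + s * (hs_inner H (u i) x - l x))
      by ring.
    eapply Rle_trans; [apply Rabs_triang|]. rewrite Rabs_Ropp, Rabs_mult.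
    assert (Rabs s * Rabs (hs_inner H (u i) x - l x) <= e / 2); [|lra].
    apply Rle_trans with ((Rabs s + 1) * (e / 2 / (Rabs s + 1)));
      [|apply Req_le; field; lra].
    assert (Q := Rabs_pos s). assert (Q' := Rabs_pos (hs_inner H (u i) x - l x)).
    apply Rmult_le_compat; lra.
  - intros x. apply Rle_plus_epsilon. intros e He.
    destruct (U_ex _ (U_and _ _ Hc (Hl x _ He))) as [i (A & B)].
    replace (l x) with (hs_inner H (u i) x + - (hs_inner H (u i) x - l x)) by ring.
    eapply Rle_trans; [apply Rabs_triang|]. rewrite Rabs_Ropp.
    assert (D := cauchy_schwarz_abs H (u i) x).
    assert (hnorm H (u i) * hnorm H x <= c * hnorm H x)
      by (apply Rmult_le_compat_r; [apply hnorm_nonneg|easy]). lra.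
  - exists v. intros w. rewrite Hv. apply Hl.
Qed.

(** Lower semicontinuity: tested against [v] itself, [|v|^2] is nearly [<u i, v>], which is at most
    the mean of [|u i|^2] and [|v|^2]. *)
Lemma weak_limit_hnorm (H : HilbertSpace) (u : I -> H) (v : H) (K : R) :
  weak_limit H u v -> (forall e, 0 < e -> U (fun i => hnorm H (u i) ^ 2 <= K + e)) ->
  hnorm H v ^ 2 <= K.
Proof.
  intros Hv HK. apply Rle_plus_epsilon. intros e He.
  assert (He3 : 0 < e / 3) by lra.
  destruct (U_ex _ (U_and _ _ (Hv v _ He3) (HK _ He3))) as [i (A & B)].
  apply Rabs_def2 in A. assert (D := cauchy_schwarz H (u i) v).
  rewrite <- hnorm_sqr in A.
  assert (0 <= (hnorm H (u i) - hnorm H v) ^ 2) by apply pow2_ge_0. nra.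
Qed.

End UltrafilterLimit.

(** The index pairs a finite list with a precision: the [p]-th map obeys both bounds on its list up
    to [1/(N+1)]. Weak limits then remove the error, because both bounds concern norms and these are
    lower semicontinuous. *)
Lemma lipschitz_smoothing (T : Type) (d : T -> T -> R) (H : HilbertSpace) (f : T -> H)
  (M a b : R) :
  (forall x, d x x = 0) -> (forall x y, d x y = d y x) ->
  (forall n P pi, stationary_reversible n P pi -> forall (z : nat -> T) t,
     fsum n (fun i => fsum n (fun j => pi i * mpow n P t i j * d (z i) (z j) ^ 2))
     <= M ^ 2 * INR t *
        fsum n (fun i => fsum n (fun j => pi i * P i j * d (z i) (z j) ^ 2))) ->
  0 <= a -> 0 <= b ->
  (forall x y, hdist H (f x) (f y) ^ 2 <= 2 * a + 2 * b * d x y ^ 2) ->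
  exists F : T -> H,
    (forall x, hdist H (F x) (f x) ^ 2 <= a) /\
    (forall x y, hdist H (F x) (F y) ^ 2 <= 2 * b * M ^ 2 * d x y ^ 2).
Proof.
  intros d0 dsym HM Ha Hb Hf.
  assert (Fin : forall p : list T * nat, exists F : T -> H,
    (forall x, In x (fst p) -> hdist H (F x) (f x) ^ 2 <= a + / INR (S (snd p))) /\
    (forall x y, In x (fst p) -> In y (fst p) ->
       hdist H (F x) (F y) ^ 2 <= 2 * b * M ^ 2 * d x y ^ 2 + / INR (S (snd p)))).
  { intros [l N]. cbn [fst snd]. destruct l as [|x0 l0]; [exists f; split; contradiction|].
    set (l := x0 :: l0). set (z := fun i => nth i l x0).
    destruct (finite_smoothing H (length l) (fun i j => d (z i) (z j)) (fun i => f (z i))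
      M a b) with (e := / INR (S N)) as [F [F1 F2]]; auto.
    { apply Rinv_0_lt_compat, lt_0_INR; lia. }
    (* A listed point may occur several times, so one position is chosen for it; points off the list
       get an arbitrary one. *)
    assert (Idx : forall x, exists i, In x l -> (i < length l)%nat /\ z i = x).
    { intros x. destruct (classic (In x l)) as [Hx|Hx]; [|now exists 0%nat].
      destruct (In_nth l x x0 Hx) as [i Hi]. now exists i. }
    destruct (choice _ Idx) as [idx Hidx].
    exists (fun x => F (idx x)). split.
    - intros x Hx. destruct (Hidx x Hx) as [A B]. specialize (F1 _ A).
      now rewrite B in F1.
    - intros x y Hx Hy. destruct (Hidx x Hx) as [A B]. destruct (Hidx y Hy) as [A' B'].
      specialize (F2 _ _ A A'). now rewrite B, B' in F2. }
  destruct (choice _ Fin) as [F HF].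
  (* The filter of tails of the directed set of pairs, ordered by inclusion and by precision. *)
  destruct (exists_ultrafilter (list T * nat) (fun A => exists l N, forall l' N',
      incl l l' -> (N <= N')%nat -> A (l', N'))) as [U (UF & Uex & Uand & Umono & Uultra)].
  - now exists nil, 0%nat.
  - intros (l & N & Q). apply (Q l N); [apply incl_refl|lia].
  - intros A B (l & N & Q) (l2 & N2 & Q2). exists (l ++ l2), (Nat.max N N2).
    intros l' N' Hl HN. split.
    + apply Q; [|lia]. intros x Hx. apply Hl, in_or_app. now left.
    + apply Q2; [|lia]. intros x Hx. apply Hl, in_or_app. now right.
  - intros A B S (l & N & Q). exists l, N. auto.
  - assert (Small : forall e, 0 < e -> exists N, forall N', (N <= N')%nat -> / INR (S N') <= e).
    { intros e He. destruct (archimed_cor1 e He) as [N [HN HN0]]. exists N.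
      intros N' HN'. apply Rle_trans with (/ INR N); [|lra].
      apply Rinv_le_contravar; [apply lt_0_INR; lia|apply le_INR; lia]. }
    assert (C1 : forall x e, 0 < e ->
              U (fun p => hdist H (F p x) (f x) ^ 2 <= a + e)).
    { intros x e He. destruct (Small e He) as [N HN]. apply UF.
      exists (x :: nil), N. intros l' N' Hl HN'.
      destruct (HF (l', N')) as [Q _]. specialize (HN N' HN'). cbn [fst snd] in Q.
      specialize (Q x (Hl x (or_introl eq_refl))). lra. }
    assert (C2 : forall x y e, 0 < e ->
              U (fun p => hdist H (F p x) (F p y) ^ 2 <= 2 * b * M ^ 2 * d x y ^ 2 + e)).
    { intros x y e He. destruct (Small e He) as [N HN]. apply UF.
      exists (x :: y :: nil), N. intros l' N' Hl HN'.
      destruct (HF (l', N')) as [_ Q]. specialize (HN N' HN'). cbn [fst snd] in Q.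
      specialize (Q x y (Hl x (or_introl eq_refl)) (Hl y (or_intror (or_introl eq_refl)))).
      lra. }
    assert (Wk : forall x, exists v, weak_limit _ U H (fun p => vs_sub H (F p x) (f x)) v).
    (* The limit is taken of the displacement from [f x]. Its squared norm is at most [a + 1], which
       is at least 1, so its norm is at most [a + 1] too. *)
    { intros x. apply ultra_weak_limit with (c := a + 1); auto.
      apply (Umono (fun p => hdist H (F p x) (f x) ^ 2 <= a + 1)); [|apply C1; lra].
      intros p Hp. unfold hdist in Hp.
      assert (N := hnorm_nonneg H (vs_sub H (F p x) (f x))). nra. }
    destruct (choice _ Wk) as [v Hv].
    exists (fun x => vs_add H (f x) (v x)). split.
    + intros x. unfold hdist.
      replace (vs_sub H (vs_add H (f x) (v x)) (f x)) with (v x).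
      * apply weak_limit_hnorm with (I := (list T * nat)%type) (U := U)
          (u := fun p => vs_sub H (F p x) (f x)); auto.
        intros e He. apply C1. easy.
      * apply inner_ext. intros w. rewrite inner_sub_l, hs_inner_add. ring.
    + intros x y. unfold hdist.
      apply weak_limit_hnorm with (I := (list T * nat)%type) (U := U)
        (u := fun p => vs_sub H (F p x) (F p y)); auto.
      2:{ intros e He. apply C2. easy. }
      intros w e He. assert (He2 : 0 < e / 2) by lra.
      apply (Umono _ _) with (2 := Uand _ _ (Hv x w _ He2) (Hv y w _ He2)).
      intros p [A B]. rewrite !inner_sub_l, !hs_inner_add in *.
      apply Rabs_def2 in A, B. apply Rabs_def1; lra.
Qed.

(** * From Markov type 2 to threshold embeddings *)

Section VectorSpaceFacts.

Variable V : VectorSpace.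

Lemma vs_add_cancel (x y z : V) : vs_add V x y = vs_add V x z -> y = z.
Proof.
  intros E. rewrite <- (vs_add_zero V y), <- (vs_add_zero V z), <- (vs_add_opp V x).
  rewrite (vs_add_comm V x), <- !vs_add_assoc. now rewrite E.
Qed.

Lemma vs_scal_zero (x : V) : vs_scal V 0 x = vs_zero V.
Proof.
  apply (vs_add_cancel (vs_scal V 0 x)).
  rewrite <- vs_scal_distr_r, Rplus_0_r, vs_add_comm. now rewrite vs_add_zero.
Qed.

Lemma vs_opp_scal (x : V) : vs_opp V x = vs_scal V (-1) x.
Proof.
  apply (vs_add_cancel x). rewrite vs_add_opp.
  rewrite <- (vs_scal_one V x) at 1. rewrite <- vs_scal_distr_r.
  replace (1 + -1) with 0 by ring. now rewrite vs_scal_zero.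
Qed.

Lemma vs_sub_add (x y : V) : vs_add V y (vs_sub V x y) = x.
Proof.
  unfold vs_sub. rewrite vs_add_comm, <- vs_add_assoc, (vs_add_comm V (vs_opp V y)).
  now rewrite vs_add_opp, vs_add_comm, vs_add_zero.
Qed.

Lemma vs_add_sub_cancel (x u v : V) :
  vs_sub V (vs_add V x u) (vs_add V x v) = vs_sub V u v.
Proof.
  apply (vs_add_cancel (vs_add V x v)). rewrite vs_sub_add.
  now rewrite <- vs_add_assoc, vs_sub_add.
Qed.

Lemma vs_sub_scal_r (a b : R) (u : V) :
  vs_sub V (vs_scal V a u) (vs_scal V b u) = vs_scal V (a - b) u.
Proof.
  unfold vs_sub. rewrite vs_opp_scal, vs_scal_assoc, <- vs_scal_distr_r. f_equal. ring.
Qed.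

Lemma vs_sub_scal_l (a : R) (x y : V) :
  vs_sub V (vs_scal V a x) (vs_scal V a y) = vs_scal V a (vs_sub V x y).
Proof.
  unfold vs_sub. rewrite !vs_opp_scal, vs_scal_distr_l, !vs_scal_assoc.
  do 2 f_equal. ring.
Qed.

Lemma vs_sub_zero_r (x : V) : vs_sub V x (vs_zero V) = x.
Proof.
  rewrite <- (vs_sub_add x (vs_zero V)) at 2. now rewrite vs_add_zero.
Qed.

End VectorSpaceFacts.

Section BanachFacts.

Variable Z : BanachSpace.

Lemma bdist_nonneg (x y : Z) : 0 <= bdist Z x y.
Proof. apply bs_norm_nonneg. Qed.

Lemma bdist_scal (a : R) (x y : Z) :
  bdist Z (vs_scal Z a x) (vs_scal Z a y) = Rabs a * bdist Z x y.
Proof. unfold bdist. now rewrite vs_sub_scal_l, bs_norm_scal. Qed.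

Lemma bdist_refl (x : Z) : bdist Z x x = 0.
Proof.
  unfold bdist, vs_sub. rewrite vs_add_opp, <- (vs_scal_zero Z (vs_zero Z)), bs_norm_scal.
  rewrite Rabs_R0. ring.
Qed.

Lemma bdist_sym (x y : Z) : bdist Z x y = bdist Z y x.
Proof.
  unfold bdist. replace (vs_sub Z x y) with (vs_scal Z (-1) (vs_sub Z y x)).
  - rewrite bs_norm_scal, Rabs_left by lra. ring.
  - rewrite <- vs_opp_scal. apply (vs_add_cancel Z (vs_sub Z y x)).
    rewrite vs_add_opp. unfold vs_sub.
    rewrite <- vs_add_assoc, (vs_add_assoc _ (vs_opp Z x)), (vs_add_comm _ (vs_opp Z x)).
    now rewrite vs_add_opp, vs_add_zero, vs_add_opp.
Qed.

(** Segments subdivide distances in [Z]. A subset [X] may lack them, so the large-scale Lipschitz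
    bound is proved on all of [Z] and only then restricted. *)
Lemma bdist_segment (x y : Z) (s : R) : 0 <= s <= 1 ->
  exists z, bdist Z x z = s * bdist Z x y /\ bdist Z z y = (1 - s) * bdist Z x y.
Proof.
  intros Hs. set (u := vs_sub Z x y).
  exists (vs_add Z y (vs_scal Z (1 - s) u)). unfold bdist. fold u. split.
  - rewrite <- (vs_sub_add Z x y) at 1. fold u.
    rewrite vs_add_sub_cancel. rewrite <- (vs_scal_one Z u) at 1.
    rewrite vs_sub_scal_r, bs_norm_scal, Rabs_pos_eq by lra. ring.
  - replace y with (vs_add Z y (vs_zero Z)) at 2 by (rewrite vs_add_comm; apply vs_add_zero).
    rewrite vs_add_sub_cancel, vs_sub_zero_r, bs_norm_scal, Rabs_pos_eq by lra. ring.
Qed.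

(** A segment is cut into at most [1 + d / eta] pieces of length at most [eta], and [f] moves at
    most [w] on each. *)
Lemma large_scale_lipschitz (H : HilbertSpace) (f : Z -> H) (eta w : R) :
  0 < eta -> (forall x y, bdist Z x y <= eta -> hdist H (f x) (f y) <= w) ->
  forall x y, hdist H (f x) (f y) <= w * (1 + bdist Z x y / eta).
Proof.
  intros Heta Hw.
  assert (Chain : forall n x y, bdist Z x y <= INR (S n) * eta ->
            hdist H (f x) (f y) <= INR (S n) * w).
  { induction n as [|n IH]; intros x y Hxy.
    - simpl in *. rewrite Rmult_1_l in *. auto.
    - rewrite (S_INR (S n)) in *. set (m := INR (S n)) in *.
      assert (Hm : 0 < m) by (apply lt_0_INR; lia).
      assert (Hm1 : 0 < / (m + 1)) by (apply Rinv_0_lt_compat; lra).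
      assert (Em : / (m + 1) * (m + 1) = 1) by (field; lra).
      (* One of [m + 1] equal pieces is cut off, leaving [m] of them for the induction
         hypothesis. *)
      destruct (bdist_segment x y (/ (m + 1))) as [z [A B]]; [split; nra|].
      assert (P := bdist_nonneg x y).
      assert (Hstep : / (m + 1) * bdist Z x y <= eta).
      { apply Rle_trans with (/ (m + 1) * ((m + 1) * eta)); [apply Rmult_le_compat_l; lra|].
        apply Req_le. field. lra. }
      assert (hdist H (f x) (f z) <= w) by (apply Hw; now rewrite A).
      assert (hdist H (f z) (f y) <= m * w).
      { apply IH. rewrite B.
        replace (1 - / (m + 1)) with (m * / (m + 1)) by (field; lra).
        rewrite Rmult_assoc. apply Rmult_le_compat_l; lra. }
      assert (T := hdist_triangle H (f x) (f z) (f y)). lra. }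
  intros x y. assert (P := bdist_nonneg x y).
  assert (Q : 0 <= bdist Z x y / eta).
  { apply Rmult_le_pos; [easy|]. now apply Rlt_le, Rinv_0_lt_compat. }
  assert (W : 0 <= w).
  { eapply Rle_trans; [apply hdist_nonneg|apply (Hw x x)]. rewrite bdist_refl. lra. }
  destruct (archimed (bdist Z x y / eta)) as [U1 U2].
  set (k := up (bdist Z x y / eta)) in *.
  assert (Hk : (1 <= k)%Z).
  { assert (0 < k)%Z; [|lia]. apply lt_IZR. lra. }
  assert (Ek : INR (S (Z.to_nat (k - 1))) = IZR k).
  { rewrite INR_IZR_INZ. f_equal. lia. }
  apply Rle_trans with (IZR k * w).
  - rewrite <- Ek. apply Chain. rewrite Ek.
    apply (Rmult_le_reg_r (/ eta)); [now apply Rinv_0_lt_compat|].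
    rewrite Rmult_assoc, Rinv_r, Rmult_1_r by lra. unfold Rdiv in U1. lra.
  - rewrite Rmult_comm. apply Rmult_le_compat_l; lra.
Qed.

(** What the two kinds of embedding share. A coarse embedding fixes the small scale and finds a far
    scale that beats its oscillation; a uniform embedding fixes the separation and finds a small
    scale with little oscillation. The factor 5 leaves [3 * w] after both ends move by [w]. *)
Lemma embedding_gap (H : HilbertSpace) (f : Z -> H) :
  coarse_embedding Z H f \/ uniform_embedding Z H f ->
  exists eta w D, 0 < eta /\ 0 < w /\ 0 < D /\
    (forall x y, bdist Z x y <= eta -> hdist H (f x) (f y) <= w) /\
    (forall x y, D <= bdist Z x y -> 5 * w <= hdist H (f x) (f y)).
Proof.
  intros [(alpha & beta & [A0 A1] & _ & Binf & AB)|(_ & Uf & Uinv)].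
  - destruct (Binf (5 * (alpha 1 + 1))) as [T HT].
    assert (P : 0 <= alpha 1) by (apply A0; lra).
    (* Adding 1 makes [w] positive even if [alpha 1] is zero. *)
    exists 1, (alpha 1 + 1), (Rmax T 1).
    assert (R1 := Rmax_l T 1). assert (R2 := Rmax_r T 1).
    repeat split; try lra.
    + intros x y Hxy. destruct (AB x y) as [_ Q].
      assert (alpha (bdist Z x y) <= alpha 1) by (apply A1; [apply bdist_nonneg|easy]). lra.
    + intros x y Hxy. destruct (AB x y) as [Q _].
      eapply Rle_trans; [|exact Q]. apply HT. lra.
  - destruct (Uinv 1) as [delta [Hd Q]]; [lra|].
    destruct (Uf (delta / 5)) as [eta [He Q']]; [lra|].
    (* Halving [eta] turns the strict inequality of uniform continuity into a weak one. *)
    exists (eta / 2), (delta / 5), 1. repeat split; try lra.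
    + intros x y Hxy. left. apply Q'. lra.
    + intros x y Hxy. apply Rnot_lt_le. intros C.
      assert (bdist Z x y < 1) by (apply Q; lra). lra.
Qed.

(** The dilation by [D / tau] moves the threshold [tau] to the scale [D] at which [f] separates
    points, so one map [f] serves all thresholds with the same constant. *)
Lemma markov_type2_threshold (H : HilbertSpace) (f : Z -> H) (X : Z -> Prop) :
  coarse_embedding Z H f \/ uniform_embedding Z H f ->
  markov_type2 (subset_dist Z X) -> threshold_embeds (subset_dist Z X) H.
Proof.
  intros Hf [M [M0 HM]].
  destruct (embedding_gap H f Hf) as (eta & w & D & He & Hw & HD & Up & Low).
  assert (Lip := large_scale_lipschitz H f eta w He Up).
  (* Chosen so that [L * tau / K = w] for the Lipschitz constant [L = 2 * c * M] below, whatever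
     [tau] is. *)
  exists (2 * M * D / eta).
  assert (HK : 0 < 2 * M * D / eta) by (apply Rdiv_lt_0_compat; nra).
  split; [exact HK|]. intros tau Htau.
  set (s := D / tau). assert (Hs : 0 < s) by (apply Rdiv_lt_0_compat; lra).
  set (c := w * s / eta).
  assert (Hc : 0 < c) by (apply Rdiv_lt_0_compat; nra).
  set (g := fun x : {z : Z | X z} => f (vs_scal Z s (proj1_sig x))).
  (* The dilated map satisfies [|g x - g y| <= w + c d], and [(w + c d)^2 <= 2 w^2 + 2 c^2 d^2]. *)
  destruct (lipschitz_smoothing _ (subset_dist Z X) H g M (w ^ 2) (c ^ 2))
    as [F [F1 F2]].
  - intros x. apply bdist_refl.
  - intros x y. apply bdist_sym.
  - exact HM.
  - apply pow2_ge_0.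
  - apply pow2_ge_0.
  - intros x y. unfold g.
    assert (Q := Lip (vs_scal Z s (proj1_sig x)) (vs_scal Z s (proj1_sig y))).
    rewrite bdist_scal, Rabs_pos_eq in Q by lra.
    change (bdist Z (proj1_sig x) (proj1_sig y)) with (subset_dist Z X x y) in Q.
    set (d := subset_dist Z X x y) in *.
    replace (w * (1 + s * d / eta)) with (w + c * d) in Q by (unfold c; field; lra).
    apply Rle_trans with ((w + c * d) ^ 2).
    + apply pow_incr. split; [apply hdist_nonneg|easy].
    + assert (0 <= (w - c * d) ^ 2) by apply pow2_ge_0. nra.
  (* Smoothing gives the constant [sqrt 2 * c * M]; it is rounded up to avoid the root. *)
  - exists F, (2 * c * M). assert (HcM : 0 < c * M) by nra.
    repeat split; [lra| |].
    + intros x y. specialize (F2 x y).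
      assert (P : 0 <= subset_dist Z X x y) by apply bdist_nonneg.
      set (d := subset_dist Z X x y) in *. assert (P' := hdist_nonneg H (F x) (F y)).
      apply Rsqr_incr_0_var; [|nra]. rewrite !Rsqr_pow2.
      eapply Rle_trans; [exact F2|].
      replace ((2 * c * M * d) ^ 2) with (2 * (2 * c ^ 2 * M ^ 2 * d ^ 2)) by ring.
      assert (0 <= 2 * c ^ 2 * M ^ 2 * d ^ 2); [|lra].
      replace (2 * c ^ 2 * M ^ 2 * d ^ 2) with (2 * (c * M * d) ^ 2) by ring.
      assert (0 <= (c * M * d) ^ 2) by apply pow2_ge_0. lra.
    + intros x y Hxy.
      replace (2 * c * M * tau / (2 * M * D / eta)) with w
        by (unfold c, s; field; repeat split; lra).
      assert (Q : 5 * w <= hdist H (g x) (g y)).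
      { apply Low. rewrite bdist_scal, Rabs_pos_eq by lra.
        apply Rle_trans with (s * tau); [apply Req_le; unfold s; field; lra|].
        apply Rmult_le_compat_l; [lra|exact Hxy]. }
      assert (N : forall z, hdist H (F z) (g z) <= w).
      { intros z. specialize (F1 z). apply Rsqr_incr_0_var; [|lra].
        now rewrite !Rsqr_pow2. }
      assert (T1 := hdist_triangle H (g x) (F x) (g y)).
      assert (T2 := hdist_triangle H (F x) (F y) (g y)).
      assert (N1 := N x). assert (N2 := N y). rewrite (hdist_sym H (F x) (g x)) in N1. lra.
Qed.

End BanachFacts.

(** * Expectations over stationary paths *)

Fixpoint step_sum (w : nat -> nat -> R) (p : list nat) : R :=
  match p with
  | nil => 0
  | i :: l => match l with
              | nil => 0
              | j :: _ => w i j + step_sum w l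
              end
  end.

Fixpoint run {A : Type} (step : A -> nat -> nat -> A) (a : A) (i : nat) (l : list nat) : A :=
  match l with
  | nil => a
  | j :: l' => run step (step a i j) j l'
  end.

Lemma step_sum_cons w i j l : step_sum w (i :: j :: l) = w i j + step_sum w (j :: l).
Proof. reflexivity. Qed.

Lemma step_sum_le n w w' p :
  (forall i j, (i < n)%nat -> (j < n)%nat -> w i j <= w' i j) ->
  Forall (fun i => (i < n)%nat) p -> step_sum w p <= step_sum w' p.
Proof.
  intros Hw. induction p as [|i [|j l] IH]; intros Hp; [simpl; lra..|].
  rewrite !step_sum_cons. inversion Hp as [|? ? Hi Hl]; subst.
  assert (Hj := Forall_inv Hl). specialize (Hw i j Hi Hj). specialize (IH Hl). lra.
Qed.

Lemma step_sum_zero p : step_sum (fun _ _ => 0) p = 0.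
Proof. induction p as [|i [|j l] IH]; [easy..|]. rewrite step_sum_cons, IH. ring. Qed.

Lemma step_sum_nonneg n w p :
  (forall i j, (i < n)%nat -> (j < n)%nat -> 0 <= w i j) ->
  Forall (fun i => (i < n)%nat) p -> 0 <= step_sum w p.
Proof.
  intros Hw Hp. rewrite <- (step_sum_zero p). now apply step_sum_le with n.
Qed.

Lemma step_sum_fsum N (w : nat -> nat -> nat -> R) p :
  fsum N (fun k => step_sum (w k) p) = step_sum (fun i j => fsum N (fun k => w k i j)) p.
Proof.
  induction p as [|i [|j l] IH]; [apply fsum_zero..|].
  rewrite step_sum_cons, <- IH, <- fsum_plus. reflexivity.
Qed.

Lemma step_sum_scal c w p : step_sum (fun i j => c * w i j) p = c * step_sum w p.
Proof.
  induction p as [|i [|j l] IH]; [simpl; ring..|]. rewrite !step_sum_cons, IH. ring.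
Qed.

Lemma hd_rev (l : list nat) : hd 0%nat (rev l) = last l 0%nat.
Proof.
  destruct l as [|x l _] using rev_ind; [easy|]. now rewrite rev_unit, last_last.
Qed.

Section PathExpectation.

Variables (n : nat) (P : nat -> nat -> R) (pi : nat -> R).
Hypothesis HP : stationary_reversible n P pi.

(* Expectation of [G (Z_1 :: .. :: Z_t)] for the chain started at [i]. *)
Fixpoint walk_expect (t i : nat) (G : list nat -> R) : R :=
  match t with
  | O => G nil
  | S t' => fsum n (fun j => P i j * walk_expect t' j (fun l => G (j :: l)))
  end.

Definition path_expect (t : nat) (G : list nat -> R) : R :=
  fsum n (fun i => pi i * walk_expect t i (fun l => G (i :: l))).

Lemma walk_expect_le t i G G' : (i < n)%nat ->
  (forall l, Forall (fun j => (j < n)%nat) l -> G l <= G' l) ->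
  walk_expect t i G <= walk_expect t i G'.
Proof.
  revert i G G'. induction t as [|t IH]; intros i G G' Hi E; simpl.
  - apply E. constructor.
  - apply fsum_le. intros j Hj. apply Rmult_le_compat_l; [now apply (kernel_nonneg n P pi)|].
    apply IH; [easy|]. intros l Hl. apply E. now constructor.
Qed.

Lemma walk_expect_ext t i G G' : (forall l, G l = G' l) ->
  walk_expect t i G = walk_expect t i G'.
Proof.
  revert i G G'. induction t as [|t IH]; intros i G G' E; simpl; [easy|].
  apply fsum_ext. intros j _. f_equal. apply IH. intros; apply E.
Qed.

Lemma walk_expect_plus t i G G' :
  walk_expect t i (fun l => G l + G' l) = walk_expect t i G + walk_expect t i G'.
Proof.
  revert i G G'. induction t as [|t IH]; intros i G G'; simpl; [easy|].
  rewrite <- fsum_plus. apply fsum_ext. intros j _. rewrite IH. ring.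
Qed.

Lemma walk_expect_scal t i c G :
  walk_expect t i (fun l => c * G l) = c * walk_expect t i G.
Proof.
  revert i G. induction t as [|t IH]; intros i G; simpl; [easy|].
  rewrite <- fsum_scal. apply fsum_ext. intros j _. rewrite IH. ring.
Qed.

Lemma walk_expect_const t i c : (i < n)%nat -> walk_expect t i (fun _ => c) = c.
Proof.
  revert i. induction t as [|t IH]; intros i Hi; simpl; [easy|].
  rewrite (fsum_ext _ _ (fun j => P i j * c)) by (intros; now rewrite IH).
  rewrite fsum_scal_r, (kernel_sum n P pi HP i Hi). ring.
Qed.

Lemma walk_expect_fsum t i N (c : nat -> R) G :
  walk_expect t i (fun l => fsum N (fun k => c k * G k l)) =
  fsum N (fun k => c k * walk_expect t i (G k)).
Proof.
  induction N as [|N IH]; simpl.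
  - rewrite (walk_expect_ext t i _ (fun _ => 0 * 0)) by (intros; ring).
    rewrite walk_expect_scal. ring.
  - now rewrite walk_expect_plus, walk_expect_scal, IH.
Qed.

Lemma path_expect_le t G G' :
  (forall p, Forall (fun i => (i < n)%nat) p -> p <> nil -> G p <= G' p) ->
  path_expect t G <= path_expect t G'.
Proof.
  intros E. apply fsum_le. intros i Hi.
  apply Rmult_le_compat_l; [now apply (pi_nonneg n P pi)|].
  apply walk_expect_le; [easy|]. intros l Hl. apply E; [now constructor|easy].
Qed.

Lemma path_expect_plus t G G' :
  path_expect t (fun p => G p + G' p) = path_expect t G + path_expect t G'.
Proof.
  unfold path_expect. rewrite <- fsum_plus. apply fsum_ext. intros i _.
  rewrite <- Rmult_plus_distr_l. f_equal.
  apply (walk_expect_plus t i (fun l => G (i :: l)) (fun l => G' (i :: l))).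
Qed.

Lemma path_expect_scal t c G : path_expect t (fun p => c * G p) = c * path_expect t G.
Proof.
  unfold path_expect. rewrite <- fsum_scal. apply fsum_ext. intros i _.
  rewrite (walk_expect_scal t i c (fun l => G (i :: l))). ring.
Qed.

Lemma path_expect_const t c : path_expect t (fun _ => c) = c.
Proof.
  unfold path_expect. rewrite (fsum_ext _ _ (fun i => pi i * c))
    by (intros; now rewrite walk_expect_const).
  rewrite fsum_scal_r, (pi_sum n P pi HP). ring.
Qed.

Lemma path_expect_fsum t N G :
  path_expect t (fun p => fsum N (fun k => G k p)) = fsum N (fun k => path_expect t (G k)).
Proof.
  induction N as [|N IH]; simpl; [apply path_expect_const|].
  now rewrite path_expect_plus, IH.
Qed.

Lemma path_expect_start t (g : nat -> R) :
  path_expect t (fun p => g (hd 0%nat p)) = fsum n (fun i => pi i * g i).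
Proof.
  apply fsum_ext. intros i Hi. f_equal. simpl. now apply walk_expect_const.
Qed.

(** By stationarity each of the [t] transitions has the law of the first one. *)
Lemma path_expect_step_sum t w :
  path_expect t (step_sum w) = INR t * fsum n (fun i => fsum n (fun j => pi i * P i j * w i j)).
Proof.
  induction t as [|t IH].
  - unfold path_expect. simpl.
    rewrite (fsum_ext _ _ (fun _ => 0)) by (intros; ring). rewrite fsum_zero. ring.
  - unfold path_expect. rewrite S_INR, Rmult_plus_distr_r, Rmult_1_l, <- IH.
    rewrite (fsum_ext _ _ (fun i => fsum n (fun j => pi i * P i j * w i j) +
      pi i * fsum n (fun j => P i j * walk_expect t j (fun l => step_sum w (j :: l))))).
    + rewrite fsum_plus, (pi_kernel_sum n P pi HP). unfold path_expect. ring.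
    + intros i Hi. cbn [walk_expect].
      rewrite <- fsum_scal, <- fsum_scal, <- fsum_plus. apply fsum_ext. intros j Hj.
      rewrite (walk_expect_ext t j _ (fun l => w i j + step_sum w (j :: l)))
        by (intros; now rewrite step_sum_cons).
      rewrite (walk_expect_plus t j (fun _ => w i j)), walk_expect_const by easy. ring.
Qed.

Lemma walk_expect_last t i (h : nat -> R) : (i < n)%nat ->
  walk_expect t i (fun l => h (last (i :: l) 0%nat)) = fsum n (fun j => mpow n P t i j * h j).
Proof.
  revert i. induction t as [|t IH]; intros i Hi.
  - simpl. now rewrite fsum_delta.
  - cbn [walk_expect].
    rewrite (fsum_ext _ _ (fun j => P i j * fsum n (fun k => mpow n P t j k * h k))).
    + rewrite (fsum_ext _ (fun j => mpow n P (S t) i j * h j)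
        (fun j => fsum n (fun k => P i k * mpow n P t k j * h j))).
      * rewrite fsum_swap. apply fsum_ext. intros k _. rewrite <- fsum_scal.
        apply fsum_ext. intros; ring.
      * intros j Hj. rewrite mpow_succ_left by easy. now rewrite fsum_scal_r.
    + intros j Hj. f_equal. rewrite <- IH by easy. now apply walk_expect_ext.
Qed.

Lemma path_expect_ends t (g : nat -> nat -> R) :
  path_expect t (fun p => g (hd 0%nat p) (last p 0%nat)) =
  fsum n (fun i => fsum n (fun j => pi i * mpow n P t i j * g i j)).
Proof.
  apply fsum_ext. intros i Hi. cbn [hd].
  rewrite (walk_expect_last t i (g i) Hi), <- fsum_scal.
  apply fsum_ext. intros; ring.
Qed.

Lemma walk_expect_snoc t i G :
  walk_expect (S t) i G =
  walk_expect t i (fun l => fsum n (fun j => P (last (i :: l) 0%nat) j * G (l ++ j :: nil))).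
Proof.
  revert i G. induction t as [|t IH]; intros i G; [easy|].
  cbn [walk_expect] in *. apply fsum_ext. intros j _. f_equal.
  rewrite (IH j (fun l => G (j :: l))). now apply walk_expect_ext.
Qed.

(** Detailed balance makes the stationary path law invariant under time reversal; this is what
    supplies the backward martingale. *)
Lemma path_expect_rev t G : path_expect t G = path_expect t (fun p => G (rev p)).
Proof.
  revert G. induction t as [|t IH]; intros G; [easy|].
  (* Balance turns the first state into a transition out of the second. Once the rest is reversed,
     that transition is a new last step. *)
  transitivity (path_expect t (fun p => fsum n (fun i => P (hd 0%nat p) i * G (i :: p)))).
  - unfold path_expect. cbn [walk_expect hd].
    rewrite (fsum_ext _ _ (fun i => fsum n (fun j => pi i * P i j *
      walk_expect t j (fun l => G (i :: j :: l)))))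
      by (intros; rewrite <- fsum_scal; apply fsum_ext; intros; ring).
    rewrite fsum_swap. apply fsum_ext. intros j Hj.
    rewrite (walk_expect_fsum t j n (fun i => P j i) (fun i l => G (i :: j :: l))).
    rewrite <- fsum_scal. apply fsum_ext. intros i Hi.
    rewrite (pi_reversible n P pi HP i j Hi Hj). ring.
  - rewrite IH. unfold path_expect. apply fsum_ext. intros i _. f_equal.
    rewrite walk_expect_snoc. apply walk_expect_ext. intros l.
    rewrite hd_rev. apply fsum_ext. intros j _. f_equal. f_equal.
    rewrite <- rev_unit. reflexivity.
Qed.

(** An iterated supermartingale inequality: [e] is the permitted increase per step, and the state
    [a] carries the history that [u] depends on. *)
Lemma walk_expect_potential {A : Type} (step : A -> nat -> nat -> A) (u : A -> R)
  (Inv : A -> Prop) (e : nat -> R) :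
  (forall a i j, (i < n)%nat -> (j < n)%nat -> Inv a -> Inv (step a i j)) ->
  (forall a i, (i < n)%nat -> Inv a -> fsum n (fun j => P i j * u (step a i j)) <= u a + e i) ->
  forall t a i, (i < n)%nat -> Inv a ->
  walk_expect t i (fun l => u (run step a i l)) <=
  u a + walk_expect t i (fun l => step_sum (fun k _ => e k) (i :: l)).
Proof.
  intros HI Hu t. induction t as [|t IH]; intros a i Hi Ha; simpl; [lra|].
  apply Rle_trans with (fsum n (fun j => P i j * u (step a i j) +
    P i j * walk_expect t j (fun l => step_sum (fun k _ => e k) (j :: l)))).
  - apply fsum_le. intros j Hj. rewrite <- Rmult_plus_distr_l.
    apply Rmult_le_compat_l; [now apply (kernel_nonneg n P pi)|].
    apply IH; [easy|]. now apply HI.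
  - rewrite fsum_plus.
    rewrite (fsum_ext _ (fun j => P i j * walk_expect t j (fun l =>
        e i + match l with nil => 0 | _ => _ end)) (fun j => P i j * e i + P i j *
        walk_expect t j (fun l => step_sum (fun k _ => e k) (j :: l)))).
    + rewrite fsum_plus, fsum_scal_r, (kernel_sum n P pi HP i Hi).
      specialize (Hu a i Hi Ha). lra.
    + intros j Hj. rewrite (walk_expect_plus t j (fun _ => e i)), walk_expect_const by easy.
      rewrite Rmult_plus_distr_l. reflexivity.
Qed.

End PathExpectation.

(** * Truncated martingales in Hilbert space *)

Definition path_vsum {H : HilbertSpace} (g : nat -> H) (p : list nat) : H :=
  fold_right (fun i v => vs_add H (g i) v) (vs_zero H) p.

Lemma path_vsum_app {H : HilbertSpace} (g : nat -> H) p q :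
  path_vsum g (p ++ q) = vs_add H (path_vsum g p) (path_vsum g q).
Proof.
  induction p as [|i p IH]; simpl; [now rewrite vs_add_zero|].
  now rewrite IH, vs_add_assoc.
Qed.

Lemma path_vsum_rev {H : HilbertSpace} (g : nat -> H) p :
  path_vsum g (rev p) = path_vsum g p.
Proof.
  induction p as [|i p IH]; simpl; [easy|].
  rewrite path_vsum_app, IH, vs_add_comm. simpl.
  now rewrite (vs_add_comm _ (g i) (vs_zero H)), vs_add_zero.
Qed.

Section TruncatedMartingale.

Variables (n : nat) (P : nat -> nat -> R) (pi : nat -> R).
Hypothesis HP : stationary_reversible n P pi.
Variables (H : HilbertSpace) (f : nat -> H) (d : nat -> nat -> R).
Hypothesis d_nonneg : forall i j, 0 <= d i j.
Hypothesis f_lip : forall i j, hdist H (f j) (f i) <= d i j.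
Variable tau : R.

Local Notation inner := (hs_inner H).

Definition small_jump (i j : nat) : R := if Rle_dec (d i j) tau then 1 else 0.

Definition drift (i : nat) : H :=
  vsum H n (fun j => vs_scal H (P i j) (vs_sub H (f j) (f i))).

Definition small_drift (i : nat) : H :=
  vsum H n (fun j => vs_scal H (P i j) (vs_scal H (small_jump i j) (vs_sub H (f j) (f i)))).

(** Discarding long jumps shifts the conditional mean, so the truncated jump is recentred to be a
    martingale difference. *)
Definition small_incr (i j : nat) : H :=
  vs_sub H (vs_scal H (small_jump i j) (vs_sub H (f j) (f i))) (small_drift i).

Definition mean_jump (i : nat) : R := fsum n (fun j => P i j * d i j).
Definition mean_sqr_jump (i : nat) : R := fsum n (fun j => P i j * d i j ^ 2).
Definition mean_big_jump (i : nat) : R :=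
  fsum n (fun j => P i j * ((1 - small_jump i j) * d i j)).
Definition mean_small_pow4 (i : nat) : R :=
  fsum n (fun j => P i j * (small_jump i j * d i j) ^ 4).

(* The state is (martingale, accumulated conditional variance); a step is skipped when it
   would push the variance above [tau ^ 2], which is a predictable decision. *)
Definition stopped_step (a : H * R) (i j : nat) : H * R :=
  if Rle_dec (snd a + mean_sqr_jump i) (tau ^ 2)
  then (vs_add H (fst a) (small_incr i j), snd a + mean_sqr_jump i)
  else a.

Lemma small_jump_01 i j : small_jump i j = 0 \/ small_jump i j = 1.
Proof. unfold small_jump. destruct Rle_dec; auto. Qed.

Lemma inner_small_drift i w :
  inner (small_drift i) w =
  fsum n (fun j => P i j * inner (vs_scal H (small_jump i j) (vs_sub H (f j) (f i))) w).
Proof.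
  unfold small_drift. rewrite inner_vsum_l. apply fsum_ext. intros; apply hs_inner_scal.
Qed.

Lemma small_incr_centered i w : (i < n)%nat ->
  fsum n (fun j => P i j * inner w (small_incr i j)) = 0.
Proof.
  intros Hi. unfold small_incr.
  rewrite (fsum_ext _ _ (fun j => P i j *
    inner (vs_scal H (small_jump i j) (vs_sub H (f j) (f i))) w
    - P i j * inner (small_drift i) w)).
  - rewrite fsum_minus, fsum_scal_r, (kernel_sum n P pi HP i Hi), <- inner_small_drift. ring.
  - intros j _. rewrite hs_inner_sym, inner_sub_l. ring.
Qed.

Lemma small_jump_norm i j :
  hnorm H (vs_scal H (small_jump i j) (vs_sub H (f j) (f i))) <= small_jump i j * d i j.
Proof.
  rewrite hnorm_scal. assert (Q := f_lip i j). unfold hdist in Q.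
  destruct (small_jump_01 i j) as [-> | ->].
  - rewrite Rabs_R0. lra.
  - rewrite Rabs_R1. lra.
Qed.

Lemma mean_sqr_jump_nonneg i : (i < n)%nat -> 0 <= mean_sqr_jump i.
Proof.
  intros Hi. apply fsum_nonneg. intros j Hj.
  apply Rmult_le_pos; [now apply (kernel_nonneg n P pi)|apply pow2_ge_0].
Qed.

(** Recentring at the mean and truncation both decrease the second moment. *)
Lemma small_incr_variance i : (i < n)%nat ->
  fsum n (fun j => P i j * hnorm H (small_incr i j) ^ 2) <= mean_sqr_jump i.
Proof.
  intros Hi. set (c := small_drift i).
  set (y := fun j => vs_scal H (small_jump i j) (vs_sub H (f j) (f i))).
  rewrite (fsum_ext _ _ (fun j => P i j * hnorm H (y j) ^ 2
    - 2 * (P i j * inner (y j) c) + P i j * hnorm H c ^ 2)).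
  - rewrite fsum_plus, fsum_minus, fsum_scal, fsum_scal_r, (kernel_sum n P pi HP i Hi).
    unfold c at 1. rewrite hnorm_sqr. unfold y at 2. rewrite <- inner_small_drift. fold c.
    assert (Q : 0 <= inner c c) by apply hs_inner_pos.
    assert (fsum n (fun j => P i j * hnorm H (y j) ^ 2) <= mean_sqr_jump i); [|lra].
    apply fsum_le. intros j Hj.
    apply Rmult_le_compat_l; [now apply (kernel_nonneg n P pi)|].
    apply pow_incr. split; [apply hnorm_nonneg|].
    eapply Rle_trans; [apply small_jump_norm|].
    assert (D := d_nonneg i j). destruct (small_jump_01 i j) as [-> | ->]; lra.
  - intros j _. unfold small_incr. fold c (y j).
    rewrite !hnorm_sqr, inner_sub_l, !inner_sub_r, (hs_inner_sym _ c (y j)). ring.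
Qed.

Lemma small_drift_norm i : (i < n)%nat ->
  hnorm H (small_drift i) <= fsum n (fun j => P i j * (small_jump i j * d i j)).
Proof.
  intros Hi. eapply Rle_trans; [apply hnorm_vsum|]. apply fsum_le. intros j Hj.
  assert (K := kernel_nonneg n P pi HP i j Hi Hj).
  rewrite hnorm_scal, Rabs_pos_eq by easy.
  apply Rmult_le_compat_l; [easy|apply small_jump_norm].
Qed.

(** From [(a + m)^4 <= 8 (a^4 + m^4)], where Jensen bounds [m^4] by the mean of [a^4]. *)
Lemma small_incr_pow4 i : (i < n)%nat ->
  fsum n (fun j => P i j * hnorm H (small_incr i j) ^ 4) <= 16 * mean_small_pow4 i.
Proof.
  intros Hi.
  set (m := fsum n (fun j => P i j * (small_jump i j * d i j))).
  assert (Hm := small_drift_norm i Hi). fold m in Hm.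
  assert (J : m ^ 4 <= mean_small_pow4 i).
  { apply fsum_jensen_pow4; [|now apply (kernel_sum n P pi)].
    intros; now apply (kernel_nonneg n P pi). }
  apply Rle_trans with (fsum n (fun j => 8 * (P i j * (small_jump i j * d i j) ^ 4)
    + P i j * (8 * m ^ 4))).
  - apply fsum_le. intros j Hj. assert (K := kernel_nonneg n P pi HP i j Hi Hj).
    apply Rle_trans with (P i j * (8 * (small_jump i j * d i j) ^ 4 + 8 * m ^ 4));
      [|lra].
    apply Rmult_le_compat_l; [easy|].
    set (a := small_jump i j * d i j).
    apply Rle_trans with ((a + m) ^ 4).
    + apply pow_incr. split; [apply hnorm_nonneg|]. unfold small_incr.
      eapply Rle_trans; [apply hnorm_sub_triangle|].
      apply Rplus_le_compat; [apply small_jump_norm|exact Hm].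
    + assert (A1 : (a + m) ^ 2 <= 2 * (a ^ 2 + m ^ 2)).
      { assert (0 <= (a - m) ^ 2) by apply pow2_ge_0. lra. }
      assert (A2 : (a ^ 2 + m ^ 2) ^ 2 <= 2 * (a ^ 4 + m ^ 4)).
      { assert (0 <= (a ^ 2 - m ^ 2) ^ 2) by apply pow2_ge_0. lra. }
      replace ((a + m) ^ 4) with (((a + m) ^ 2) ^ 2) by ring.
      apply Rle_trans with ((2 * (a ^ 2 + m ^ 2)) ^ 2); [|lra].
      apply pow_incr. split; [apply pow2_ge_0|exact A1].
  - rewrite fsum_plus, fsum_scal, fsum_scal_r, (kernel_sum n P pi HP i Hi).
    fold (mean_small_pow4 i). lra.
Qed.

(* [|M|^4 - 8 q |M|^2] is a supermartingale up to the fourth moments of the jumps. *)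
Definition potential (a : H * R) : R :=
  (hnorm H (fst a) ^ 2) ^ 2 - 8 * hnorm H (fst a) ^ 2 * snd a.

Lemma potential_step a i : (i < n)%nat -> 0 <= snd a ->
  fsum n (fun j => P i j * potential (stopped_step a i j))
  <= potential a + 48 * mean_small_pow4 i.
Proof.
  intros Hi Ha. destruct a as [m q]. cbn [snd] in Ha.
  assert (Q4 : 0 <= mean_small_pow4 i).
  { apply fsum_nonneg. intros j Hj. apply Rmult_le_pos; [now apply (kernel_nonneg n P pi)|].
    replace ((small_jump i j * d i j) ^ 4) with (((small_jump i j * d i j) ^ 2) ^ 2) by ring.
    apply pow2_ge_0. }
  unfold stopped_step. cbn [fst snd]. destruct Rle_dec as [Hle|Hgt].
  2:{ rewrite fsum_scal_r, (kernel_sum n P pi HP i Hi). lra. }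
  unfold potential. cbn [fst snd].
  assert (V0 := mean_sqr_jump_nonneg i Hi). set (v := mean_sqr_jump i) in *.
  set (x := hnorm H m ^ 2). assert (X : 0 <= x) by apply pow2_ge_0.
  (* Expanding [(x + 2 z + y)^2] with [z^2 <= x y] and [4 z y <= 2 z^2 + 2 y^2]. The terms in [z]
     have mean zero, and the new variance [v] in [-8 (q + v) x] pays for [8 x y]; the 48 is 3 times
     16. *)
  apply Rle_trans with (fsum n (fun j => P i j * (x ^ 2 - 8 * (q + v) * x)
    + (4 * x - 16 * (q + v)) * (P i j * inner m (small_incr i j))
    + (8 * x - 8 * (q + v)) * (P i j * hnorm H (small_incr i j) ^ 2)
    + 3 * (P i j * hnorm H (small_incr i j) ^ 4))).
  - apply fsum_le. intros j Hj. assert (K := kernel_nonneg n P pi HP i j Hi Hj).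
    set (D := small_incr i j). set (z := inner m D). set (y := hnorm H D ^ 2).
    replace (hnorm H D ^ 4) with (y ^ 2) by (unfold y; ring).
    assert (Y : 0 <= y) by apply pow2_ge_0.
    assert (E : hnorm H (vs_add H m D) ^ 2 = x + 2 * z + y).
    { unfold x, y, z. rewrite !hnorm_sqr, hs_inner_add, !inner_add_r, (hs_inner_sym _ D m).
      ring. }
    rewrite E.
    assert (Z : z ^ 2 <= x * y).
    { unfold x, y. rewrite <- Rpow_mult_distr, <- (pow2_abs z). apply pow_incr.
      split; [apply Rabs_pos|apply cauchy_schwarz_abs]. }
    replace (P i j * (x ^ 2 - 8 * (q + v) * x) + (4 * x - 16 * (q + v)) * (P i j * z)
      + (8 * x - 8 * (q + v)) * (P i j * y) + 3 * (P i j * y ^ 2))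
      with (P i j * (x ^ 2 - 8 * (q + v) * x + (4 * x - 16 * (q + v)) * z
        + (8 * x - 8 * (q + v)) * y + 3 * y ^ 2)) by ring.
    apply Rmult_le_compat_l; [easy|].
    assert (0 <= (z - y) ^ 2) by apply pow2_ge_0. nra.
  - rewrite !fsum_plus, !fsum_scal, fsum_scal_r, (kernel_sum n P pi HP i Hi).
    rewrite small_incr_centered by easy.
    assert (S2 := small_incr_variance i Hi). assert (S4 := small_incr_pow4 i Hi).
    set (s2 := fsum n (fun j => P i j * hnorm H (small_incr i j) ^ 2)) in *.
    assert (0 <= s2).
    { apply fsum_nonneg. intros j Hj.
      apply Rmult_le_pos; [now apply (kernel_nonneg n P pi)|apply pow2_ge_0]. }
    fold v in S2. nra.
Qed.

Definition stopped (p : list nat) : H * R :=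
  match p with
  | nil => (vs_zero H, 0)
  | i :: l => run stopped_step (vs_zero H, 0) i l
  end.

Definition variance (p : list nat) : R := step_sum (fun i _ => mean_sqr_jump i) p.

Lemma stopped_variance p : Forall (fun i => (i < n)%nat) p ->
  0 <= snd (stopped p) <= Rmin (variance p) (tau ^ 2).
Proof.
  assert (G : forall l i a, Forall (fun i => (i < n)%nat) (i :: l) -> 0 <= snd a <= tau ^ 2 ->
    0 <= snd (run stopped_step a i l) <= Rmin (snd a + variance (i :: l)) (tau ^ 2)).
  { induction l as [|j l IH]; intros i a Hl Ha.
    - simpl. unfold variance. simpl. rewrite Rplus_0_r, Rmin_left; lra.
    - assert (Hi := Forall_inv Hl). assert (Hl' := Forall_inv_tail Hl).
      assert (V0 := mean_sqr_jump_nonneg i Hi). cbn [run].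
      unfold variance. rewrite step_sum_cons. fold (variance (j :: l)).
      unfold stopped_step at 2 4. destruct Rle_dec as [Hle|Hgt].
      + specialize (IH j (vs_add H (fst a) (small_incr i j), snd a + mean_sqr_jump i) Hl').
        cbn [snd] in IH. rewrite Rplus_assoc in IH. apply IH. lra.
      + destruct (IH j a Hl' Ha) as [I1 I2]. split; [exact I1|].
        eapply Rle_trans; [exact I2|]. apply Rle_min_compat_r. lra. }
  intros Hp. assert (T : 0 <= tau ^ 2) by apply pow2_ge_0.
  destruct p as [|i l].
  - simpl. unfold variance. simpl. rewrite Rmin_left; lra.
  - specialize (G l i (vs_zero H, 0) Hp). cbn [snd] in G. rewrite Rplus_0_l in G.
    apply G. lra.
Qed.

(** Completing the square, [x^2 <= 2 (x^2 - 8 x q) + 64 q^2], so the supermartingale bound on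
    [potential] controls the fourth moment. *)
Lemma stopped_pow4 t :
  path_expect n P pi t (fun p => hnorm H (fst (stopped p)) ^ 4) <=
  path_expect n P pi t (fun p => 64 * Rmin (variance p) (tau ^ 2) ^ 2
    + 96 * step_sum (fun i _ => mean_small_pow4 i) p).
Proof.
  assert (Pot : path_expect n P pi t (fun p => potential (stopped p)) <=
    path_expect n P pi t (fun p => 48 * step_sum (fun i _ => mean_small_pow4 i) p)).
  { apply fsum_le. intros i Hi. apply Rmult_le_compat_l; [now apply (pi_nonneg n P pi)|].
    eapply Rle_trans.
    - apply (walk_expect_potential n P pi HP stopped_step potential (fun a => 0 <= snd a)
        (fun i => 48 * mean_small_pow4 i)).
      + intros a k l Hk _ Ha. unfold stopped_step. destruct Rle_dec; [|easy].
        assert (V0 := mean_sqr_jump_nonneg k Hk). cbn [snd]. lra.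
      + intros a k Hk Ha. now apply potential_step.
      + exact Hi.
      + simpl. lra.
    - apply Req_le. unfold potential. cbn [fst snd]. rewrite hnorm_zero.
      rewrite (walk_expect_ext n P t i _ (fun l => 48 *
        step_sum (fun i _ => mean_small_pow4 i) (i :: l))) by (intros; apply step_sum_scal).
      ring. }
  assert (Fin : path_expect n P pi t (fun p => hnorm H (fst (stopped p)) ^ 4) <=
    path_expect n P pi t (fun p => 2 * potential (stopped p)
      + 64 * Rmin (variance p) (tau ^ 2) ^ 2)).
  { apply (path_expect_le n P pi HP). intros p Hp _.
    destruct (stopped_variance p Hp) as [Q1 Q2]. unfold potential.
    destruct (stopped p) as [m q]. cbn [fst snd] in *.
    replace (hnorm H m ^ 4) with ((hnorm H m ^ 2) ^ 2) by ring.
    set (x := hnorm H m ^ 2). set (r := Rmin (variance p) (tau ^ 2)) in *.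
    assert (X : 0 <= x) by apply pow2_ge_0.
    assert (0 <= (x - 8 * q) ^ 2) by apply pow2_ge_0.
    assert (q ^ 2 <= r ^ 2) by (apply pow_incr; lra). nra. }
  eapply Rle_trans; [exact Fin|]. rewrite !path_expect_plus, !path_expect_scal in *. lra.
Qed.

(** The Doob martingale part. Its compensator runs over all states but the last; writing it as the
    full sum minus one term isolates the part that is invariant under reversal. *)
Definition path_martingale (p : list nat) : H :=
  vs_sub H (vs_sub H (f (last p 0%nat)) (f (hd 0%nat p)))
    (vs_sub H (path_vsum drift p) (drift (last p 0%nat))).

(** With no long jump and total variance below the cap, nothing is cut and no step is skipped. The
    two martingales then differ only by their drifts, that is by the means of the long jumps. *)
Lemma path_martingale_truncation p :
  Forall (fun i => (i < n)%nat) p -> p <> nil ->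
  step_sum (fun i j => 1 - small_jump i j) p < 1 -> variance p <= tau ^ 2 ->
  hnorm H (path_martingale p)
  <= hnorm H (fst (stopped p)) + step_sum (fun i _ => mean_big_jump i) p.
Proof.
  assert (DD : forall i, (i < n)%nat ->
    hnorm H (vs_sub H (small_drift i) (drift i)) <= mean_big_jump i).
  { intros i Hi. replace (vs_sub H (small_drift i) (drift i)) with
      (vsum H n (fun j => vs_scal H (- (P i j * (1 - small_jump i j)))
        (vs_sub H (f j) (f i)))).
    - eapply Rle_trans; [apply hnorm_vsum|]. apply fsum_le. intros j Hj.
      assert (K := kernel_nonneg n P pi HP i j Hi Hj). assert (L := f_lip i j).
      unfold hdist in L.
      rewrite hnorm_scal, Rabs_Ropp, Rabs_mult, (Rabs_pos_eq (P i j)), Rmult_assoc by easy.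
      apply Rmult_le_compat_l; [easy|].
      rewrite Rabs_pos_eq by (destruct (small_jump_01 i j) as [-> | ->]; lra).
      apply Rmult_le_compat_l; [destruct (small_jump_01 i j) as [-> | ->]; lra|easy].
    - apply inner_ext. intros w. unfold drift. rewrite inner_sub_l, inner_small_drift.
      rewrite !inner_vsum_l, <- fsum_minus. apply fsum_ext. intros j _.
      rewrite !hs_inner_scal. ring. }
  assert (G : forall l i a, Forall (fun i => (i < n)%nat) (i :: l) ->
    step_sum (fun i j => 1 - small_jump i j) (i :: l) < 1 ->
    snd a + variance (i :: l) <= tau ^ 2 ->
    hnorm H (vs_sub H (path_martingale (i :: l))
               (vs_sub H (fst (run stopped_step a i l)) (fst a)))
    <= step_sum (fun i _ => mean_big_jump i) (i :: l)).
  { induction l as [|j l IH]; intros i a Hl HJ HV.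
    - simpl run. unfold path_martingale. simpl.
      replace (vs_sub H _ _) with (vs_zero H); [rewrite hnorm_zero; lra|].
      apply inner_ext. intros w.
      rewrite !inner_sub_l, hs_inner_add, inner_zero_l. ring.
    - assert (Hi := Forall_inv Hl). assert (Hl' := Forall_inv_tail Hl).
      assert (Hj := Forall_inv Hl').
      rewrite step_sum_cons in HJ. unfold variance in HV. rewrite step_sum_cons in HV.
      fold (variance (j :: l)) in HV.
      assert (J0 : 0 <= step_sum (fun i j => 1 - small_jump i j) (j :: l)).
      { apply step_sum_nonneg with n; [|easy]. intros u v _ _.
        destruct (small_jump_01 u v) as [-> | ->]; lra. }
      assert (V0 : 0 <= variance (j :: l)).
      { apply step_sum_nonneg with n; [|easy]. intros; now apply mean_sqr_jump_nonneg. }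
      (* The sum counts long jumps, so being less than 1 it is zero. *)
      assert (S1 : small_jump i j = 1)
        by (destruct (small_jump_01 i j) as [E|E]; [rewrite E in HJ; lra|easy]).
      cbn [run]. unfold stopped_step at 2. destruct Rle_dec as [_|No]; [|lra].
      set (a' := (vs_add H (fst a) (small_incr i j), snd a + mean_sqr_jump i)).
      assert (I : hnorm H (vs_sub H (path_martingale (j :: l))
               (vs_sub H (fst (run stopped_step a' j l)) (fst a')))
               <= step_sum (fun i _ => mean_big_jump i) (j :: l))
        by (apply IH; [easy|rewrite S1 in HJ; lra|unfold a'; cbn [snd]; lra]).
      rewrite step_sum_cons.
      eapply Rle_trans; [|apply Rplus_le_compat; [apply (DD i Hi)|exact I]].
      eapply Rle_trans; [|apply hnorm_triangle]. apply Req_le. f_equal.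
      apply inner_ext. intros w. unfold path_martingale.
      change (last (i :: j :: l) 0%nat) with (last (j :: l) 0%nat). cbn [hd].
      change (path_vsum drift (i :: j :: l))
        with (vs_add H (drift i) (path_vsum drift (j :: l))).
      unfold a'. cbn [fst]. unfold small_incr. rewrite S1.
      rewrite !hs_inner_add, !inner_sub_l, !hs_inner_add, !inner_sub_l, !hs_inner_scal,
        !inner_sub_l. ring. }
  intros Hp Hne HJ HV. destruct p as [|i l]; [easy|]. cbn [stopped].
  specialize (G l i (vs_zero H, 0) Hp HJ). cbn [fst snd] in G.
  assert (T := hnorm_triangle H (fst (run stopped_step (vs_zero H, 0) i l))
    (vs_sub H (path_martingale (i :: l))
       (vs_sub H (fst (run stopped_step (vs_zero H, 0) i l)) (vs_zero H)))).
  assert (E : vs_add H (fst (run stopped_step (vs_zero H, 0) i l))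
    (vs_sub H (path_martingale (i :: l))
       (vs_sub H (fst (run stopped_step (vs_zero H, 0) i l)) (vs_zero H)))
    = path_martingale (i :: l)).
  { apply inner_ext. intros w. rewrite hs_inner_add, !inner_sub_l, inner_zero_l. ring. }
  rewrite E in T. specialize (G ltac:(lra)). lra.
Qed.

Lemma drift_norm i : (i < n)%nat -> hnorm H (drift i) <= mean_jump i.
Proof.
  intros Hi. eapply Rle_trans; [apply hnorm_vsum|]. apply fsum_le. intros j Hj.
  assert (K := kernel_nonneg n P pi HP i j Hi Hj).
  rewrite hnorm_scal, Rabs_pos_eq by easy.
  apply Rmult_le_compat_l; [easy|apply f_lip].
Qed.

(* Lyons-Zheng decomposition into a forward and a backward martingale. *)
Lemma forward_backward p : Forall (fun i => (i < n)%nat) p -> p <> nil ->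
  2 * hdist H (f (hd 0%nat p)) (f (last p 0%nat)) <=
  (hnorm H (path_martingale p) + mean_jump (hd 0%nat p))
  + (hnorm H (path_martingale (rev p)) + mean_jump (hd 0%nat (rev p))).
Proof.
  intros Hp Hne.
  assert (Hh : (hd 0%nat p < n)%nat).
  { destruct p; [easy|]. exact (Forall_inv Hp). }
  assert (Hl : (hd 0%nat (rev p) < n)%nat).
  { assert (Hr := Forall_rev Hp). assert (rev p <> nil).
    { intros E. apply Hne. rewrite <- (rev_involutive p), E. easy. }
    destruct (rev p); [easy|]. exact (Forall_inv Hr). }
  assert (D1 := drift_norm _ Hh). assert (D2 := drift_norm _ Hl).
  assert (Lr : last (rev p) 0%nat = hd 0%nat p) by (now rewrite <- hd_rev, rev_involutive).
  unfold path_martingale in *. rewrite hd_rev, Lr, path_vsum_rev in *.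
  set (x := f (hd 0%nat p)) in *. set (y := f (last p 0%nat)) in *.
  set (lx := drift (hd 0%nat p)) in *. set (ly := drift (last p 0%nat)) in *.
  (* This sum is the same in both time directions and cancels in [m - m'], leaving twice the
     displacement and the two end drifts. *)
  set (T := path_vsum drift p).
  set (m := vs_sub H (vs_sub H y x) (vs_sub H T ly)).
  set (m' := vs_sub H (vs_sub H x y) (vs_sub H T lx)).
  replace (2 * hdist H x y) with (hnorm H (vs_sub H (vs_sub H m m') (vs_sub H ly lx))).
  - assert (T1 := hnorm_sub_triangle H (vs_sub H m m') (vs_sub H ly lx)).
    assert (T2 := hnorm_sub_triangle H m m'). assert (T3 := hnorm_sub_triangle H ly lx). lra.
  - rewrite hdist_sym. unfold hdist.
    replace 2 with (Rabs 2) by (apply Rabs_pos_eq; lra).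
    rewrite <- hnorm_scal. f_equal. apply inner_ext. intros w. unfold m, m'.
    rewrite hs_inner_scal, !inner_sub_l. ring.
Qed.

End TruncatedMartingale.

(** * Summation over dyadic scales *)

Definition reached (x w : R) : R := if Rle_dec x w then 1 else 0.

Lemma reached_nonneg x w : 0 <= reached x w.
Proof. unfold reached. destruct Rle_dec; lra. Qed.

(** The terms that survive are those at most [w]; with ratio at least 2 they add up to at most twice
    the largest. *)
Lemma geometric_reached (s r w : R) (N : nat) : 0 < s -> 2 <= r -> 0 <= w ->
  fsum N (fun k => s * r ^ k * reached (s * r ^ k) w) <= 2 * w.
Proof.
  intros Hs Hr Hw.
  (* All terms before the [N]-th together do not exceed the [N]-th power. *)
  assert (Full : forall N, fsum N (fun k => s * r ^ k * reached (s * r ^ k) w) <= s * r ^ N).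
  { intros M. induction M as [|M IH]; simpl; [lra|].
    assert (0 < s * r ^ M) by (apply Rmult_lt_0_compat; [easy|apply pow_lt; lra]).
    assert (reached (s * r ^ M) w <= 1) by (unfold reached; destruct Rle_dec; lra).
    replace (s * (r * r ^ M)) with (r * (s * r ^ M)) by ring. nra. }
  induction N as [|N IH]; simpl; [lra|].
  unfold reached at 2. destruct Rle_dec as [Hle|]; [|lra].
  specialize (Full N). lra.
Qed.

(** Below [w] the terms grow like [a], above it they decay like [w^2 / a]. *)
Lemma geometric_truncated_sqr (s r w : R) (N : nat) : 0 < s -> 2 <= r -> 0 <= w ->
  fsum N (fun k => Rmin w (s * r ^ k) ^ 2 / (s * r ^ k)) <= 4 * w.
Proof.
  intros Hs Hr Hw.
  (* In the decaying regime [2 w^2 / a] is kept in reserve: it bounds the whole remaining tail. *)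
  assert (Inv : let a := s * r ^ N in
    (a <= w /\ fsum N (fun k => Rmin w (s * r ^ k) ^ 2 / (s * r ^ k)) <= a) \/
    (w < a /\ fsum N (fun k => Rmin w (s * r ^ k) ^ 2 / (s * r ^ k)) <= 4 * w - 2 * (w ^ 2 / a))).
  { cbn zeta.
    assert (Pos : forall k, 0 < s * r ^ k)
      by (intros; apply Rmult_lt_0_compat; [easy|apply pow_lt; lra]).
    assert (Quot : forall a, 0 < a -> w < a -> w ^ 2 / a <= w).
    { intros a Ha Hwa. apply (Rmult_le_reg_r a); [easy|].
      unfold Rdiv. rewrite Rmult_assoc, Rinv_l by lra. nra. }
    induction N as [|N IH].
    - simpl. rewrite Rmult_1_r. destruct (Rle_lt_dec s w) as [L|L]; [left; lra|right].
      specialize (Quot s Hs L). lra.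
    - cbn [fsum]. assert (PN := Pos N). assert (PS := Pos (S N)).
      assert (Es : s * r ^ S N = r * (s * r ^ N)) by (simpl; ring).
      set (a := s * r ^ N) in *. set (a' := s * r ^ S N) in *.
      set (F := fsum N (fun k => Rmin w (s * r ^ k) ^ 2 / (s * r ^ k))) in *.
      destruct IH as [[L IF]|[L IF]].
      + rewrite (Rmin_right w a) by easy.
        replace (a ^ 2 / a) with a by (field; lra).
        destruct (Rle_lt_dec a' w) as [L'|L']; [left; split; [easy|nra]|right].
        split; [easy|]. specialize (Quot a' PS L'). lra.
      + right. split; [nra|]. rewrite (Rmin_left w a) by lra.
        assert (w ^ 2 / a' <= w ^ 2 / a / 2); [|lra].
        rewrite Es. replace (w ^ 2 / (r * a)) with (w ^ 2 / a * / r) by (field; lra).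
        unfold Rdiv at 2. apply Rmult_le_compat_l.
        * apply Rmult_le_pos; [apply pow2_ge_0|now apply Rlt_le, Rinv_0_lt_compat].
        * apply Rinv_le_contravar; lra. }
  cbn zeta in Inv.
  assert (P : 0 < s * r ^ N) by (apply Rmult_lt_0_compat; [easy|apply pow_lt; lra]).
  destruct Inv as [[L IF]|[L IF]]; [lra|].
  assert (0 <= w ^ 2 / (s * r ^ N)).
  { apply Rmult_le_pos; [apply pow2_ge_0|now apply Rlt_le, Rinv_0_lt_compat]. }
  lra.
Qed.

(** The highest layer [a] reached satisfies [x < 2 a], hence the factor 4; [s ^ 2] covers the case
    where no layer is reached. *)
Lemma dyadic_layers (s x : R) (N : nat) : 0 < s -> 0 <= x -> x < s * 2 ^ N ->
  x ^ 2 <= s ^ 2 + 4 * fsum N (fun k => (s * 2 ^ k) ^ 2 * reached (s * 2 ^ k) x).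
Proof.
  intros Hs Hx. induction N as [|N IH]; intros HN; simpl in HN.
  - simpl. nra.
  - cbn [fsum]. set (a := s * 2 ^ N) in *.
    assert (Ha : 0 <= a ^ 2 * reached a x)
      by (apply Rmult_le_pos; [apply pow2_ge_0|apply reached_nonneg]).
    destruct (Rle_lt_dec a x) as [L|L]; [|specialize (IH L); lra].
    assert (F : 0 <= fsum N (fun k => (s * 2 ^ k) ^ 2 * reached (s * 2 ^ k) x)).
    { apply fsum_nonneg. intros. apply Rmult_le_pos; [apply pow2_ge_0|apply reached_nonneg]. }
    unfold reached at 2. destruct Rle_dec as [_|]; [|lra].
    assert (x < 2 * a) by (unfold a; lra).
    assert (x ^ 2 <= (2 * a) ^ 2) by (apply pow_incr; lra).
    assert (0 <= s ^ 2) by apply pow2_ge_0. lra.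
Qed.

(** * From threshold embeddings to Markov type 2 *)

Section ThresholdChain.

Variables (n : nat) (P : nat -> nat -> R) (pi : nat -> R).
Hypothesis HP : stationary_reversible n P pi.
Variable d : nat -> nat -> R.
Hypothesis d_nonneg : forall i j, 0 <= d i j.
Hypothesis d_sym : forall i j, d i j = d j i.
Variable K : R.
Hypothesis K_pos : 0 < K.

(* Dominates [tau ^ 2] times the probability that a forward martingale part exceeds its
   share of [tau / K]. *)
Definition scale_bound (tau : R) (p : list nat) : R :=
  tau ^ 2 * step_sum (fun i j => 1 - small_jump d tau i j) p
  + tau ^ 2 * reached (tau ^ 2) (variance n P d p)
  + 3 * K * tau * step_sum (fun i _ => mean_big_jump n P d tau i) p
  + 81 * K ^ 4 / tau ^ 2 * (64 * Rmin (variance n P d p) (tau ^ 2) ^ 2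
      + 96 * step_sum (fun i _ => mean_small_pow4 n P d tau i) p)
  + tau ^ 2 * reached (tau ^ 2) (9 * K ^ 2 * mean_jump n P d (hd 0%nat p) ^ 2).

(** If the ends are [tau] apart, the forward or the backward part is at least [tau / K]. Reversal
    makes both equally likely, whence the factor 2, and a union bound with the fourth moment
    estimates one of them. *)
Lemma threshold_scale (H : HilbertSpace) (f : nat -> H) (tau : R) (t : nat) :
  0 < tau ->
  (forall i j, hdist H (f i) (f j) <= d i j) ->
  (forall i j, tau <= d i j -> tau / K <= hdist H (f i) (f j)) ->
  tau ^ 2 * path_expect n P pi t (fun p => reached tau (d (hd 0%nat p) (last p 0%nat)))
  <= 2 * path_expect n P pi t (scale_bound tau).
Proof.
  intros Htau Hf Hthr.
  assert (f_lip : forall i j, hdist H (f j) (f i) <= d i j)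
    by (intros; rewrite d_sym; apply Hf).
  assert (HKt : 0 < 3 * K / tau) by (apply Rdiv_lt_0_compat; lra).
  (* The inverse of the share [theta]: [tau / K] is split in three, between the stopped martingale,
     the drift of long jumps and the end drift. *)
  set (c := 3 * K / tau) in *.
  assert (Ec : c * (tau / (3 * K)) = 1) by (unfold c; field; lra).
  assert (Htk : 0 < tau / (3 * K)) by (apply Rdiv_lt_0_compat; lra).
  set (theta := tau / (3 * K)) in *.
  assert (Et : tau / K = 3 * theta) by (unfold theta; field; lra).
  (* One summand for each way a forward part can be large; whichever occurs, its summand is at least
     1. *)
  set (Th := fun p : list nat =>
    step_sum (fun i j => 1 - small_jump d tau i j) p
    + reached (tau ^ 2) (variance n P d p)
    + c * step_sum (fun i _ => mean_big_jump n P d tau i) p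
    + c ^ 4 * hnorm H (fst (stopped n P H f d tau p)) ^ 4
    + reached (tau ^ 2) (9 * K ^ 2 * mean_jump n P d (hd 0%nat p) ^ 2)).
  assert (Mbig : forall i, (i < n)%nat -> 0 <= mean_big_jump n P d tau i).
  { intros i Hi. apply fsum_nonneg. intros j Hj.
    apply Rmult_le_pos; [now apply (kernel_nonneg n P pi)|].
    apply Rmult_le_pos; [destruct (small_jump_01 d tau i j) as [-> | ->]; lra|easy]. }
  assert (Th_large : forall p, Forall (fun i => (i < n)%nat) p -> p <> nil ->
    3 * theta <= hnorm H (path_martingale n P H f p) + mean_jump n P d (hd 0%nat p) ->
    1 <= Th p).
  { intros p Hp Hne Hlarge. unfold Th.
    assert (J0 : 0 <= step_sum (fun i j => 1 - small_jump d tau i j) p).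
    { apply step_sum_nonneg with n; [|easy]. intros u v _ _.
      destruct (small_jump_01 d tau u v) as [-> | ->]; lra. }
    assert (B0 : 0 <= step_sum (fun i _ => mean_big_jump n P d tau i) p)
      by (apply step_sum_nonneg with n; auto).
    assert (N0 := hnorm_nonneg H (fst (stopped n P H f d tau p))).
    assert (R1 := reached_nonneg (tau ^ 2) (variance n P d p)).
    assert (R2 := reached_nonneg (tau ^ 2) (9 * K ^ 2 * mean_jump n P d (hd 0%nat p) ^ 2)).
    assert (C4 : 0 <= c ^ 4 * hnorm H (fst (stopped n P H f d tau p)) ^ 4)
      by (apply Rmult_le_pos; apply pow_le; lra).
    set (J := step_sum (fun i j => 1 - small_jump d tau i j) p) in *.
    set (B := step_sum (fun i _ => mean_big_jump n P d tau i) p) in *.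
    set (x := hnorm H (fst (stopped n P H f d tau p))) in *.
    set (a := mean_jump n P d (hd 0%nat p)) in *.
    assert (CB : 0 <= c * B) by (apply Rmult_le_pos; lra).
    destruct (Rle_lt_dec 1 J) as [HJ|HJ]; [lra|].
    destruct (Rle_lt_dec (tau ^ 2) (variance n P d p)) as [HV|HV].
    { unfold reached at 1. destruct Rle_dec; [lra|contradiction]. }
    destruct (Rle_lt_dec theta a) as [Ha|Ha].
    { unfold reached at 2. destruct Rle_dec as [|No]; [lra|]. exfalso. apply No.
      replace tau with (3 * K * theta) by (unfold theta; field; lra).
      replace (9 * K ^ 2 * a ^ 2) with ((3 * K * a) ^ 2) by ring.
      apply pow_incr. split; [apply Rmult_le_pos; lra|]. apply Rmult_le_compat_l; lra. }
    assert (Q := path_martingale_truncation n P pi HP H f d f_lip tau p Hp Hne HJ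
      (Rlt_le _ _ HV)). fold B x in Q.
    destruct (Rle_lt_dec theta B) as [HB|HB].
    { assert (c * theta <= c * B) by (apply Rmult_le_compat_l; lra). lra. }
    assert (Hx : theta <= x) by lra.
    assert (1 <= c ^ 4 * x ^ 4); [|lra].
    rewrite <- Rpow_mult_distr. apply pow_R1_Rle.
    rewrite <- Ec. apply Rmult_le_compat_l; lra. }
  assert (Th_nonneg : forall p, Forall (fun i => (i < n)%nat) p -> 0 <= Th p).
  { intros p Hp. unfold Th. repeat apply Rplus_le_le_0_compat.
    - apply step_sum_nonneg with n; [|easy]. intros u v _ _.
      destruct (small_jump_01 d tau u v) as [-> | ->]; lra.
    - apply reached_nonneg.
    - apply Rmult_le_pos; [lra|]. apply step_sum_nonneg with n; auto.
    - apply Rmult_le_pos; apply pow_le; [lra|apply hnorm_nonneg].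
    - apply reached_nonneg. }
  assert (S1 : path_expect n P pi t (fun p => reached tau (d (hd 0%nat p) (last p 0%nat)))
    <= path_expect n P pi t (fun p => Th p + Th (rev p))).
  { apply (path_expect_le n P pi HP). intros p Hp Hne.
    assert (Hr := Forall_rev Hp).
    assert (Hrne : rev p <> nil).
    { intros E. apply Hne. rewrite <- (rev_involutive p), E. easy. }
    assert (T1 := Th_nonneg p Hp). assert (T2 := Th_nonneg (rev p) Hr).
    unfold reached at 1. destruct Rle_dec as [Hd|]; [|lra].
    specialize (Hthr _ _ Hd). rewrite Et in Hthr.
    assert (FB := forward_backward n P pi HP H f d f_lip p Hp Hne).
    destruct (Rle_lt_dec (3 * theta)
      (hnorm H (path_martingale n P H f p) + mean_jump n P d (hd 0%nat p))) as [L|L].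
    - specialize (Th_large p Hp Hne L). lra.
    - specialize (Th_large (rev p) Hr Hrne). lra. }
  rewrite path_expect_plus, <- (path_expect_rev n P pi HP) in S1.
  assert (S2 : tau ^ 2 * path_expect n P pi t Th <= path_expect n P pi t (scale_bound tau)).
  { assert (Q := stopped_pow4 n P pi HP H f d d_nonneg f_lip tau t).
    unfold Th, scale_bound. rewrite !path_expect_plus, !path_expect_scal.
    assert (E4 : tau ^ 2 * c ^ 4 = 81 * K ^ 4 / tau ^ 2) by (unfold c; field; lra).
    assert (E1 : tau ^ 2 * c = 3 * K * tau) by (unfold c; field; lra).
    rewrite !Rmult_plus_distr_l, <- !Rmult_assoc, E4, E1.
    assert (0 <= 81 * K ^ 4 / tau ^ 2).
    { rewrite <- E4. apply Rmult_le_pos; [apply pow2_ge_0|apply pow_le; lra]. }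
    apply (Rmult_le_compat_l (81 * K ^ 4 / tau ^ 2)) in Q; [|easy]. lra. }
  assert (0 <= tau ^ 2) by apply pow2_ge_0.
  apply (Rmult_le_compat_l (tau ^ 2)) in S1; [|easy]. lra.
Qed.

(** The sum over scales is taken path by path: each term of [scale_bound] is one of the two
    geometric series in a single jump, in the variance or in the mean jump at the start. *)
Lemma scale_bound_sum (s : R) (N : nat) (p : list nat) : 0 < s ->
  Forall (fun i => (i < n)%nat) p -> p <> nil ->
  fsum N (fun k => scale_bound (s * 2 ^ k) p) <=
  2 * step_sum (fun i j => d i j ^ 2) p
  + (2 + 6 * K + 51840 * K ^ 4) * variance n P d p
  + 18 * K ^ 2 * mean_jump n P d (hd 0%nat p) ^ 2.
Proof.
  intros Hs Hp Hne.
  set (tau := fun k : nat => s * 2 ^ k).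
  assert (Htau : forall k, 0 < tau k)
    by (intros; apply Rmult_lt_0_compat; [easy|apply pow_lt; lra]).
  assert (Etau : forall k, tau k ^ 2 = s ^ 2 * 4 ^ k).
  { intros k. unfold tau. rewrite Rpow_mult_distr, <- !pow_mult, (Nat.mul_comm k), pow_mult.
    do 2 f_equal. ring. }
  assert (Hs2 : 0 < s ^ 2) by (apply pow_lt; lra).
  set (V := variance n P d p).
  assert (HV : 0 <= V).
  { apply step_sum_nonneg with n; [|easy]. intros; now apply (mean_sqr_jump_nonneg n P pi). }
  assert (K2 : 0 <= K ^ 2) by apply pow2_ge_0.
  assert (K4 : 0 <= K ^ 4) by (apply pow_le; lra).
  assert (Big : forall k i j, 1 - small_jump d (tau k) i j <= reached (tau k) (d i j)).
  { intros k i j. unfold small_jump, reached. destruct Rle_dec, Rle_dec; lra. }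
  assert (B1 : fsum N (fun k => tau k ^ 2 *
      step_sum (fun i j => 1 - small_jump d (tau k) i j) p)
    <= 2 * step_sum (fun i j => d i j ^ 2) p).
  { rewrite (fsum_ext _ _ (fun k => step_sum (fun i j =>
      tau k ^ 2 * (1 - small_jump d (tau k) i j)) p)) by (intros; now rewrite step_sum_scal).
    rewrite step_sum_fsum, <- step_sum_scal. apply step_sum_le with n; [|easy].
    intros i j _ _.
    eapply Rle_trans; [|apply (geometric_reached (s ^ 2) 4 (d i j ^ 2) N);
      [easy|lra|apply pow2_ge_0]].
    apply fsum_le. intros k _. rewrite <- Etau.
    apply Rmult_le_compat_l; [apply pow2_ge_0|].
    eapply Rle_trans; [apply Big|]. unfold reached.
    destruct Rle_dec as [L|L], Rle_dec as [L'|L']; try lra.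
    exfalso. apply L'. apply pow_incr. split; [now apply Rlt_le|easy]. }
  assert (B2 : forall w, 0 <= w ->
    fsum N (fun k => tau k ^ 2 * reached (tau k ^ 2) w) <= 2 * w).
  { intros w Hw. eapply Rle_trans; [|apply (geometric_reached (s ^ 2) 4 w N); lra].
    apply fsum_le. intros k _. rewrite Etau. lra. }
  assert (B3 : fsum N (fun k => 3 * K * tau k *
      step_sum (fun i _ => mean_big_jump n P d (tau k) i) p) <= 6 * K * V).
  { rewrite (fsum_ext _ _ (fun k => 3 * K * step_sum (fun i _ =>
      tau k * mean_big_jump n P d (tau k) i) p))
      by (intros; rewrite step_sum_scal; ring).
    rewrite fsum_scal, step_sum_fsum.
    replace (6 * K * V) with (3 * K * (2 * V)) by ring.
    apply Rmult_le_compat_l; [lra|]. unfold V, variance. rewrite <- step_sum_scal.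
    apply step_sum_le with n; [|easy]. intros i _ Hi _.
    unfold mean_big_jump, mean_sqr_jump.
    rewrite (fsum_ext N _ (fun k => fsum n (fun j => tau k *
      (P i j * ((1 - small_jump d (tau k) i j) * d i j)))))
      by (intros; now rewrite fsum_scal).
    rewrite fsum_swap, <- fsum_scal. apply fsum_le. intros j Hj.
    assert (Kn := kernel_nonneg n P pi HP i j Hi Hj).
    assert (Dn := d_nonneg i j).
    apply Rle_trans with (fsum N (fun k => P i j * d i j *
      (s * 2 ^ k * reached (s * 2 ^ k) (d i j)))).
    - apply fsum_le. intros k _. specialize (Big k i j). fold (tau k).
      replace (tau k * (P i j * ((1 - small_jump d (tau k) i j) * d i j)))
        with (P i j * d i j * (tau k * (1 - small_jump d (tau k) i j))) by ring.
      apply Rmult_le_compat_l; [now apply Rmult_le_pos|].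
      apply Rmult_le_compat_l; [now apply Rlt_le|easy].
    - rewrite fsum_scal.
      assert (G := geometric_reached s 2 (d i j) N Hs (Rle_refl 2) Dn).
      apply (Rmult_le_compat_l (P i j * d i j)) in G; [|now apply Rmult_le_pos]. lra. }
  assert (B4 : forall w, 0 <= w ->
    fsum N (fun k => Rmin w (tau k ^ 2) ^ 2 / tau k ^ 2) <= 4 * w).
  { intros w Hw. eapply Rle_trans; [|apply (geometric_truncated_sqr (s ^ 2) 4 w N); lra].
    apply fsum_le. intros k _. rewrite Etau. lra. }
  assert (B5 : fsum N (fun k => / tau k ^ 2 *
      step_sum (fun i _ => mean_small_pow4 n P d (tau k) i) p) <= 4 * V).
  { rewrite (fsum_ext _ _ (fun k => step_sum (fun i _ =>
      / tau k ^ 2 * mean_small_pow4 n P d (tau k) i) p))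
      by (intros; now rewrite step_sum_scal).
    rewrite step_sum_fsum. unfold V, variance. rewrite <- step_sum_scal.
    apply step_sum_le with n; [|easy]. intros i _ Hi _.
    unfold mean_small_pow4, mean_sqr_jump.
    rewrite (fsum_ext N _ (fun k => fsum n (fun j => / tau k ^ 2 *
      (P i j * (small_jump d (tau k) i j * d i j) ^ 4)))) by (intros; now rewrite fsum_scal).
    rewrite fsum_swap, <- fsum_scal. apply fsum_le. intros j Hj.
    assert (Kn := kernel_nonneg n P pi HP i j Hi Hj).
    assert (Dn := d_nonneg i j).
    apply Rle_trans with (fsum N (fun k => P i j *
      (Rmin (d i j ^ 2) (tau k ^ 2) ^ 2 / tau k ^ 2))).
    - apply fsum_le. intros k _. specialize (Htau k).
      replace (/ tau k ^ 2 * (P i j * (small_jump d (tau k) i j * d i j) ^ 4))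
        with (P i j * ((small_jump d (tau k) i j * d i j) ^ 4 * / tau k ^ 2)) by ring.
      apply Rmult_le_compat_l; [easy|].
      apply Rmult_le_compat_r; [apply Rlt_le, Rinv_0_lt_compat, pow_lt; lra|].
      unfold small_jump. destruct Rle_dec as [L|L].
      + rewrite Rmin_left by (apply pow_incr; lra). apply Req_le. ring.
      + rewrite Rmult_0_l, pow_i by lia. apply pow2_ge_0.
    - rewrite fsum_scal. specialize (B4 (d i j ^ 2) (pow2_ge_0 _)).
      apply (Rmult_le_compat_l (P i j)) in B4; [|easy]. lra. }
  set (a := mean_jump n P d (hd 0%nat p)).
  assert (A0 : 0 <= 9 * K ^ 2 * a ^ 2)
    by (apply Rmult_le_pos; [lra|apply pow2_ge_0]).
  unfold scale_bound. fold V a.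
  (* Here 5184 is 81 times 64 and 7776 is 81 times 96; both series contribute a factor 4, which
     gives the 51840. *)
  rewrite (fsum_ext _ _ (fun k =>
    tau k ^ 2 * step_sum (fun i j => 1 - small_jump d (tau k) i j) p
    + tau k ^ 2 * reached (tau k ^ 2) V
    + 3 * K * tau k * step_sum (fun i _ => mean_big_jump n P d (tau k) i) p
    + 5184 * K ^ 4 * (Rmin V (tau k ^ 2) ^ 2 / tau k ^ 2)
    + 7776 * K ^ 4 * (/ tau k ^ 2 * step_sum (fun i _ => mean_small_pow4 n P d (tau k) i) p)
    + tau k ^ 2 * reached (tau k ^ 2) (9 * K ^ 2 * a ^ 2))).
  2:{ intros k _. fold (tau k). specialize (Htau k). field. lra. }
  rewrite !fsum_plus, !fsum_scal.
  assert (C1 := B2 V HV). assert (C2 := B2 _ A0). assert (C3 := B4 V HV).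
  apply (Rmult_le_compat_l (5184 * K ^ 4)) in C3; [|lra].
  apply (Rmult_le_compat_l (7776 * K ^ 4)) in B5; [|lra].
  lra.
Qed.

(** The factor 8 is 4 from the dyadic layers times 2 from the two martingales. *)
Lemma threshold_chain (t : nat) :
  (forall i, d i i = 0) ->
  (forall tau, 0 < tau -> exists (H : HilbertSpace) (f : nat -> H),
     (forall i j, hdist H (f i) (f j) <= d i j) /\
     (forall i j, tau <= d i j -> tau / K <= hdist H (f i) (f j))) ->
  fsum n (fun i => fsum n (fun j => pi i * mpow n P t i j * d i j ^ 2))
  <= 8 * (4 + 6 * K + 51840 * K ^ 4 + 18 * K ^ 2) * INR t *
     fsum n (fun i => fsum n (fun j => pi i * P i j * d i j ^ 2)).
Proof.
  intros d0 Hemb.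
  set (E1 := fsum n (fun i => fsum n (fun j => pi i * P i j * d i j ^ 2))).
  set (C := 4 + 6 * K + 51840 * K ^ 4 + 18 * K ^ 2).
  assert (K2 : 0 <= K ^ 2) by apply pow2_ge_0.
  assert (K4 : 0 <= K ^ 4) by (apply pow_le; lra).
  assert (HE1 : 0 <= E1).
  { apply fsum_nonneg; intros; apply fsum_nonneg; intros.
    apply Rmult_le_pos; [apply Rmult_le_pos|apply pow2_ge_0];
      [now apply (pi_nonneg n P pi)|now apply (kernel_nonneg n P pi)]. }
  (* Time zero is treated apart: the mean jump at the start carries no factor [t] and is absorbed
     through [1 <= t]. *)
  destruct t as [|t'].
  { apply Req_le. simpl INR. rewrite Rmult_0_r, Rmult_0_l.
    transitivity (fsum n (fun _ => 0)); [|apply fsum_zero]. apply fsum_ext. intros i Hi.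
    transitivity (fsum n (fun _ => 0)); [|apply fsum_zero]. apply fsum_ext. intros j Hj.
    simpl. destruct (Nat.eqb_spec i j) as [->|]; [rewrite d0|]; ring. }
  set (t := S t').
  assert (Ht : 1 <= INR t) by (unfold t; rewrite S_INR; assert (Q := pos_INR t'); lra).
  rewrite <- (path_expect_ends n P pi t (fun i j => d i j ^ 2)).
  set (L := path_expect n P pi t _).
  set (D := fsum n (fun i => fsum n (fun j => d i j))).
  assert (HdD : forall i j, (i < n)%nat -> (j < n)%nat -> d i j <= D).
  { intros i j Hi Hj. apply Rle_trans with (fsum n (fun j => d i j)).
    - now apply (fsum_term_le n (fun j => d i j)).
    - apply (fsum_term_le n (fun i => fsum n (fun j => d i j))); [|easy].
      intros; now apply fsum_nonneg. }
  (* The lowest scale [s] is arbitrary and the number of scales, chosen to pass the largest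
     distance, leaves no trace in the bound. Letting [s] tend to 0 removes [s ^ 2]. *)
  assert (Scale : forall s, 0 < s -> L <= s ^ 2 + 8 * C * INR t * E1).
  { intros s Hs.
    destruct (Pow_x_infinity 2) with (b := D / s + 1) as [N HN].
    { rewrite Rabs_pos_eq; lra. }
    specialize (HN N (le_n N)). rewrite Rabs_pos_eq in HN by (apply pow_le; lra).
    assert (HDN : D < s * 2 ^ N).
    { assert (X : D / s < 2 ^ N) by lra.
      apply (Rmult_lt_compat_l s) in X; [|easy].
      replace (s * (D / s)) with D in X by (field; lra). exact X. }
    set (tau := fun k : nat => s * 2 ^ k).
    assert (Htau : forall k, 0 < tau k)
      by (intros; apply Rmult_lt_0_compat; [easy|apply pow_lt; lra]).
    apply Rle_trans with (path_expect n P pi t (fun p => s ^ 2 + 4 * fsum N (fun k =>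
      tau k ^ 2 * reached (tau k) (d (hd 0%nat p) (last p 0%nat))))).
    { apply (path_expect_le n P pi HP). intros p Hp Hne.
      apply dyadic_layers; [easy|easy|]. eapply Rle_lt_trans; [|exact HDN].
      apply HdD.
      - destruct p; [easy|]. exact (Forall_inv Hp).
      - rewrite <- hd_rev. assert (Hr := Forall_rev Hp). assert (rev p <> nil).
        { intros E. apply Hne. rewrite <- (rev_involutive p), E. easy. }
        destruct (rev p); [easy|]. exact (Forall_inv Hr). }
    rewrite path_expect_plus, (path_expect_const n P pi HP), path_expect_scal,
      (path_expect_fsum n P pi HP).
    apply Rplus_le_compat_l.
    apply Rle_trans with (4 * fsum N (fun k => 2 * path_expect n P pi t (scale_bound (tau k)))).
    { apply Rmult_le_compat_l; [lra|]. apply fsum_le. intros k _.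
      rewrite path_expect_scal. destruct (Hemb (tau k) (Htau k)) as (H & f & F1 & F2).
      now apply threshold_scale with H f. }
    rewrite fsum_scal, <- (path_expect_fsum n P pi HP).
    assert (Q : path_expect n P pi t (fun p => fsum N (fun k => scale_bound (tau k) p))
      <= C * INR t * E1); [|lra].
    eapply Rle_trans.
    { apply (path_expect_le n P pi HP). intros p Hp Hne. now apply scale_bound_sum. }
    rewrite !path_expect_plus, !path_expect_scal.
    unfold variance. rewrite !(path_expect_step_sum n P pi HP). fold E1.
    rewrite (path_expect_start n P pi HP t (fun i => mean_jump n P d i ^ 2)).
    replace (fsum n (fun i => fsum n (fun j => pi i * P i j * mean_sqr_jump n P d i))) with E1.
    2:{ apply fsum_ext. intros i Hi.
        rewrite (fsum_ext _ (fun j => pi i * P i j * mean_sqr_jump n P d i)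
          (fun j => pi i * mean_sqr_jump n P d i * P i j)) by (intros; ring).
        rewrite fsum_scal, (kernel_sum n P pi HP i Hi), Rmult_1_r.
        unfold mean_sqr_jump. rewrite <- fsum_scal. apply fsum_ext. intros; ring. }
    assert (A : fsum n (fun i => pi i * mean_jump n P d i ^ 2) <= E1).
    { apply fsum_le. intros i Hi.
      apply Rle_trans with (pi i * mean_sqr_jump n P d i).
      - apply Rmult_le_compat_l; [now apply (pi_nonneg n P pi)|].
        apply fsum_jensen_sqr; [|now apply (kernel_sum n P pi)].
        intros; now apply (kernel_nonneg n P pi).
      - apply Req_le. unfold mean_sqr_jump. rewrite <- fsum_scal.
        apply fsum_ext. intros; ring. }
    assert (A' : 18 * K ^ 2 * fsum n (fun i => pi i * mean_jump n P d i ^ 2)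
      <= 18 * K ^ 2 * (INR t * E1)).
    { apply Rmult_le_compat_l; [lra|]. nra. }
    unfold C. lra. }
  apply Rle_plus_epsilon. intros e He.
  (* Then [s ^ 2 <= s <= e]. *)
  set (s := Rmin 1 e).
  assert (Hs : 0 < s) by (apply Rmin_pos; lra).
  assert (s <= 1) by apply Rmin_l. assert (s <= e) by apply Rmin_r.
  specialize (Scale s Hs). nra.
Qed.

End ThresholdChain.

(** Dividing the threshold maps by [L] makes them 1-Lipschitz, as [threshold_chain] requires. *)
Lemma threshold_markov_type2 (T : Type) (d : T -> T -> R) (H : HilbertSpace) :
  (forall x y, 0 <= d x y) -> (forall x, d x x = 0) -> (forall x y, d x y = d y x) ->
  threshold_embeds d H -> markov_type2 d.
Proof.
  intros dpos d0 dsym [K [HK Hemb]].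
  assert (K2 : 0 <= K ^ 2) by apply pow2_ge_0.
  assert (K4 : 0 <= K ^ 4) by (apply pow_le; lra).
  set (C := 8 * (4 + 6 * K + 51840 * K ^ 4 + 18 * K ^ 2)).
  assert (HC : 1 <= C) by (unfold C; lra).
  (* [C] itself serves as the Markov type constant: [C <= C ^ 2] because [1 <= C], which avoids a
     square root. *)
  exists C. split; [lra|]. intros n P pi HP z t.
  assert (Q := threshold_chain n P pi HP (fun i j => d (z i) (z j))
    (fun i j => dpos _ _) (fun i j => dsym _ _) K HK t (fun i => d0 _)).
  cbn beta in Q. fold C in Q.
  eapply Rle_trans; [apply Q|].
  - intros tau Htau. destruct (Hemb tau Htau) as (phi & L & HL & F1 & F2).
    assert (HL' : 0 < / L) by now apply Rinv_0_lt_compat.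
    assert (Sc : forall x y, hdist H (vs_scal H (/ L) x) (vs_scal H (/ L) y)
              = / L * hdist H x y).
    { intros x y. unfold hdist. rewrite vs_sub_scal_l, hnorm_scal, Rabs_pos_eq; lra. }
    exists H, (fun i => vs_scal H (/ L) (phi (z i))). split.
    + intros i j. rewrite Sc. apply (Rmult_le_reg_l L); [easy|].
      rewrite <- Rmult_assoc, Rinv_r, Rmult_1_l by lra. apply F1.
    + intros i j Hij. rewrite Sc. apply (Rmult_le_reg_l L); [easy|].
      rewrite <- Rmult_assoc, Rinv_r, Rmult_1_l by lra.
      specialize (F2 _ _ Hij). unfold Rdiv in *. lra.
  - apply Rmult_le_compat_r.
    + apply fsum_nonneg; intros; apply fsum_nonneg; intros.
      apply Rmult_le_pos; [apply Rmult_le_pos|apply pow2_ge_0];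
        [now apply (pi_nonneg n P pi)|now apply (kernel_nonneg n P pi)].
    + apply Rmult_le_compat_r; [apply pos_INR|]. nra.
Qed.

Theorem theorem5p3 (Z : BanachSpace)
  (HZ : exists (H : HilbertSpace) (f : Z -> H),
          coarse_embedding Z H f \/ uniform_embedding Z H f)
  (X : Z -> Prop) :
  markov_type2 (subset_dist Z X) <->
  exists H : HilbertSpace, threshold_embeds (subset_dist Z X) H.
Proof.
  split.
  - intros HM. destruct HZ as (H & f & Hf). exists H. now apply markov_type2_threshold with f.
  - intros [H HT]. apply threshold_markov_type2 with H; [..|exact HT].
    + intros x y. apply bdist_nonneg.
    + intros x. apply bdist_refl.
    + intros x y. apply bdist_sym.
Qed.
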